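(* Let $p>1$ and let $V:\mathbb{R}^n\to\mathbb{R}$ be an even, strictly convex, $p$-homogeneous $C^2$ function. The inequality $$\int_{\mathbb{R}^n} e^{-\Phi(x)}\,dx\,\Bigl(\int_{\mathbb{R}^n} e^{-\frac{1}{p-1}\Phi^*(\nabla V(x))}\,dx\Bigr)^{p-1}\le\Bigl(\int_{\mathbb{R}^n} e^{-V(x)}\,dx\Bigr)^p$$ holds for every even proper convex function $\Phi:\mathbb{R}^n\to(-\infty,+\infty]$ if and only if the inequality $$|K|\cdot|\nabla V^*(K^{o})|^{p-1}\le\Bigl|\Bigl\{V\le\tfrac1p\Bigr\}\Bigr|^p$$ holds for every origin-symmetric convex body $K\subset\mathbb{R}^n$. If the latter inequality holds (for all such $K$), then equality is attained when $K$ is a sublevel set of $V$, i.e. $K=\{V\le\alpha\}$, $\alpha>0$.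
   Context: $|\cdot|$ is $n$-dimensional Lebesgue measure. A convex body is a compact convex set with non-empty interior. $K^{o}=\{y:\langle x,y\rangle\le 1\ \forall x\in K\}$ is the polar body. $\Phi^*(y)=\sup_x(\langle x,y\rangle-\Phi(x))$ is the Legendre transform, $V^*$ is the Legendre transform of $V$, and $\nabla V^*(A)=\{\nabla V^*(x):x\in A\}$. $V$ is $p$-homogeneous if $V(tx)=t^pV(x)$ for all $t\ge0$. A convex function is proper if it is not identically $+\infty$. Conventions: $e^{-\infty}=0$, $0\cdot\infty=0$. *)

(* Defs.v *)
From HB Require Import structures.
From mathcomp Require Import all_boot all_order all_algebra.
From mathcomp Require Import all_classical all_reals all_analysis.

Set Implicit Arguments.
Unset Strict Implicit.
Unset Printing Implicit Defensive.

Import Order.TTheory GRing.Theory Num.Theory.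
Import numFieldNormedType.Exports.

Local Open Scope classical_set_scope.
Local Open Scope ring_scope.

(* R^n is 'rV[R]_n; the measure below needs n >= 1, hence the n.+1. *)

Section lebesgue_measure_rV.
Context {R : realType} {n : nat}.
Local Notation rV := 'rV[R]_n.+1.
Implicit Types (X : set rV) (ab : rV * rV) (F : nat -> rV * rV).

Definition box ab : set rV :=
  [set x | forall i, ab.1 0 i <= x 0 i <= ab.2 0 i].

(* The truncation at 0 gives volume 0 to the empty boxes. *)
Definition box_volume ab : R := \prod_i Num.max 0 (ab.2 0 i - ab.1 0 i).

Definition box_cover X : set (nat -> rV * rV) :=
  [set F | X `<=` \bigcup_k box (F k)].

Local Open Scope ereal_scope.

Definition lebesgue_outer X : \bar R :=
  ereal_inf [set \sum_(k <oo) (box_volume (F k))%:E | F in box_cover X].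

Let box_volume_ge0 ab : 0 <= (box_volume ab)%:E.
Proof. by rewrite lee_fin; apply: prodr_ge0 => i _; rewrite le_max lexx. Qed.

Lemma lebesgue_outer_ge0 X : 0 <= lebesgue_outer X.
Proof. by apply: le_ereal_inf_tmp => _ [F _ <-]; exact: nneseries_ge0. Qed.

Lemma lebesgue_outer0 : lebesgue_outer set0 = 0.
Proof.
apply/eqP; rewrite eq_le lebesgue_outer_ge0 andbT.
apply: ereal_inf_lbound; exists (fun=> (0%R, 0%R)) => //.
apply: eseries0 => k _ _; rewrite /box_volume/= big_ord_recl/= !mxE subrr.
by rewrite maxxx mul0r.
Qed.

Lemma le_lebesgue_outer : {homo lebesgue_outer : A B / A `<=` B >-> A <= B}.
Proof.
move=> A B AB; apply: ereal_inf_le_tmp => _ [F BF <-].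
by exists F => //; exact: subset_trans BF.
Qed.

Lemma lebesgue_outer_sigma_subadditive : sigma_subadditive lebesgue_outer.
Proof.
move=> A; have [[i ioo]|] := pselect (exists i, lebesgue_outer (A i) = +oo).
  rewrite (eseries_pinfty _ _ ioo) ?leey// => k _.
  by rewrite -ltNye (lt_le_trans _ (lebesgue_outer_ge0 _)).
rewrite -forallNE => Aoo.
suff add2e (e : {posnum R}) : lebesgue_outer (\bigcup_n A n) <=
    \sum_(i <oo) lebesgue_outer (A i) + e%:num%:E.
  by apply/lee_addgt0Pr => _/posnumP[].
rewrite (le_trans _ (epsilon_trick _ _ _))//; last first.
  by move=> k; exact: lebesgue_outer_ge0.
pose P k F := box_cover (A k) F /\ \sum_(j <oo) (box_volume (F j))%:E <=
  lebesgue_outer (A k) + (e%:num / (2 ^ k.+1)%:R)%:E.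
have [G PG] : {G : nat -> nat -> rV * rV & forall k, P k (G k)}.
  apply: (@choice _ _ P) => k.
  have en1 : (0 < e%:num / (2 ^ k.+1)%:R :> R)%R by [].
  have fA : lebesgue_outer (A k) \is a fin_num.
    by rewrite ge0_fin_numE ?lebesgue_outer_ge0// ltey; apply/eqP/Aoo.
  have [_ [F AF <-] AFe] := lb_ereal_inf_adherent en1 fA.
  by exists F; split => //; exact/ltW.
pose v := (fun ij => (box_volume ij)%:E) \o uncurry G.
have v_ge0 ij : 0 <= v ij by exact: box_volume_ge0.
apply: (@le_trans _ _ (\esum_(i in setT) v i)).
  have /card_esym/ppcard_eqP[f] := card_nat2.
  apply: ereal_inf_lbound; exists (uncurry G \o f).
    move=> t [i _ /(PG i).1[j _ Gijt]]; exists (f^-1%FUN (i, j)) => //=.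
    by rewrite invK ?inE.
  by rewrite -(esum_pred_image v _ xpredT) ?[fun=> _]set_true// image_eq.
rewrite (_ : esum _ _ = \sum_(i <oo) \sum_(j <oo) v (i, j)).
  apply: lee_lim.
  - by apply: is_cvg_nneseries => k *; exact: nneseries_ge0.
  - by apply: is_cvg_nneseries => k *; rewrite adde_ge0// lebesgue_outer_ge0.
  - by near=> k; apply: lee_sum => i _; exact: (PG i).2.
pose J : nat -> set (nat * nat) := fun i => [set (i, j) | j in setT].
rewrite (_ : setT = \bigcup_k J k); last first.
  by rewrite predeqE => -[a b]; split => // _; exists a => //; exists b.
rewrite esum_bigcupT //=; last first.
  apply/trivIsetP => i j _ _ ij.
  rewrite predeqE => -[k m] /=; split => //= -[] [_] _ [<-{k} _].
  by move=> [m' _] [] /esym/eqP; rewrite (negbTE ij).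
rewrite -(image_id [set: nat]) -fun_true esum_pred_image//; last first.
  by move=> k _; exact: esum_ge0.
apply: eq_eseriesr => /= j _.
rewrite -(esum_pred_image v (pair j) predT)//=; last first.
  by move=> ? ? _ _; exact: (@can_inj _ _ _ snd).
by congr esum; rewrite predeqE => -[a b]; split; move=> [i _ <-]; exists i.
Unshelve. all: by end_near. Qed.

HB.instance Definition _ := isOuterMeasure.Build R rV lebesgue_outer
  lebesgue_outer0 lebesgue_outer_ge0 le_lebesgue_outer
  lebesgue_outer_sigma_subadditive.

(* Like completed_lebesgue_measure on R, a measure on the sigma-algebra of all
   Lebesgue measurable sets: a convex function without semicontinuity
   assumption need not be Borel measurable. *)
Definition lebesgue_rV : set (caratheodory_type lebesgue_outer) -> \bar R :=
  lebesgue_outer.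

Let lebesgue_rV0 : lebesgue_rV set0 = 0.
Proof. exact: lebesgue_outer0. Qed.

Let lebesgue_rV_ge0 A : 0 <= lebesgue_rV A.
Proof. exact: lebesgue_outer_ge0. Qed.

Let lebesgue_rV_sigma_additive : semi_sigma_additive lebesgue_rV.
Proof. exact: caratheodory_measure_sigma_additive. Qed.

HB.instance Definition _ := isMeasure.Build _ _ _ lebesgue_rV
  lebesgue_rV0 lebesgue_rV_ge0 lebesgue_rV_sigma_additive.

End lebesgue_measure_rV.

Section convex_geometry.
Context {R : realType} {n : nat}.
Local Notation rV := 'rV[R]_n.+1.
Implicit Types (x y : rV) (K : set rV) (V : rV -> R) (Phi : rV -> \bar R).

Definition dotp x y : R := \sum_i x 0 i * y 0 i.

Definition convex_body K :=
  [/\ compact K, convex_set (K : set (convex_lmodType rV)) & K° !=set0].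

Definition origin_symmetric K := forall x, K x -> K (- x).

Definition polar K : set rV := [set y | forall x, K x -> dotp x y <= 1].

Definition even_fun (T : Type) (f : rV -> T) := forall x, f (- x) = f x.

Definition strictly_convex V := forall x y (t : R), x != y -> 0 < t < 1 ->
  V (t *: x + (1 - t) *: y) < t * V x + (1 - t) * V y.

Definition homogeneous (p : R) V := forall (t : R) x, 0 <= t ->
  V (t *: x) = t `^ p * V x.

Definition grad V x : rV := \row_i 'D_(delta_mx 0 i) V x.

Definition C2 V := [/\ forall x, differentiable V x,
  forall x, differentiable (grad V) x & continuous (jacobian (grad V))].

Local Open Scope ereal_scope.

(* Functions with values in (-oo, +oo]. *)
Definition econvex Phi := (forall x, -oo < Phi x) /\
  forall x y (t : R), (0 <= t <= 1)%R ->
    Phi (t *: x + (1 - t) *: y)%R <= t%:E * Phi x + (1 - t)%:E * Phi y.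

Definition proper_fun Phi := exists x, Phi x != +oo.

Definition legendre Phi y : \bar R :=
  ereal_sup [set (dotp x y)%:E - Phi x | x in [set: rV]].

(* V^* as a real-valued function, for V such that V^* is finite. *)
Definition legendreR V y : R := fine (legendre (EFin \o V) y).

End convex_geometry.

(* Main.v *)
From HB Require Import structures.
Require Import Defs.
From mathcomp Require Import all_boot all_order all_algebra.
From mathcomp Require Import all_classical all_reals all_analysis.
From mathcomp Require Import measurable_realfun.
From mathcomp Require Import ring lra.

Set Implicit Arguments.
Unset Strict Implicit.
Unset Printing Implicit Defensive.

Import Order.TTheory GRing.Theory Num.Theory.
Import numFieldNormedType.Exports.

Local Open Scope classical_set_scope.
Local Open Scope ring_scope.

(* Write L = {V <= 1/p}, so that {V <= r^p/p} = r L. Everything is reduced to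
   sublevel sets by the layer-cake formula: the integral of e^(-F) is the
   integral over s of e^(-s) |{F <= s}|.
   From functions to bodies: take Phi with {Phi <= r^p/p} containing r K and
   {Phi^*(grad V) / (p-1) <= r^p/p} containing r (grad V^* )(K^o); all three
   integrals are then C times a volume, with the same constant 0 < C < oo.
   From bodies to functions: if Phi^** (x) <= s and Phi^*(grad V y) <= (p-1) t
   then <x, grad V y> <= s + (p-1) t, so the two sublevel sets are polar to each
   other up to that factor, and the inequality for bodies bounds the product of
   their volumes by |{V <= (s + (p-1) t)/p}|^p. The one-dimensional
   Prekopa-Leindler inequality integrates this bound. Replacing Phi by Phi^**
   avoids any measurability question on Phi.
   Equality on {V <= a} comes from Euler's identity <x, grad V x> = p V x, which
   makes (grad V^* )({V <= a}^o) again a sublevel set of V. *)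

(** * Lebesgue measure on row vectors *)

(** The map [grad V] is a bijection with inverse [grad (legendreR V)], so the image of the polar
    body is a preimage under the continuous map [grad V]; after that, [legendreR] no longer
    intervenes. For the passage to bodies the natural candidate is [gauge_K^p / p]. It is obtained
    as the Legendre transform of an explicit formula for its conjugate: convexity, evenness and
    closed sublevel sets then come for free, and only upper bounds on [Phi] and on its transform
    remain, which is the useful direction since the functional inequality bounds the integrals from
    above. For the passage to functions the obstacle is that the sublevel sets may be unbounded or
    have empty interior, and that [s + (p - 1) t] may be nonpositive, whereas the hypothesis
    concerns bodies only. Exhaustion by balls and a limit in [0, +oo] deal with this. The exponent
    [p - 1] on the second integral matches the weights [1/p] and [1 - 1/p] in Prekopa-Leindler,
    because [s + (p - 1) t] is [p] times the corresponding mean of [s] and [t]. *)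

Section row_norm.
Context {R : realType} {n : nat}.
Implicit Types (x y : 'rV[R]_n) (e : R).

Lemma ler_norm_rV x e : 0 <= e -> (`|x| <= e) = [forall i, `|x 0 i| <= e].
Proof.
move=> e0; rewrite {1}/Num.norm/= mx_normrE; apply/bigmax_leP/forallP => /=.
  by move=> [_ h] i; exact: (h (0, i)).
by move=> h; split => // -[i j] _ /=; rewrite ord1; exact: h.
Qed.

Lemma ler_coord_norm x i : `|x 0 i| <= `|x|.
Proof. by have := ler_norm_rV x (normr_ge0 x); rewrite lexx => /esym/forallP. Qed.

End row_norm.

Section lebesgue_rV_theory.
Context {R : realType} {n : nat}.
Local Notation rV := 'rV[R]_n.+1.
Local Notation rVm := (caratheodory_type (@lebesgue_outer R n)).

(** Caratheodory's criterion holds because the hyperplane [x_i = c] cuts every box of a cover into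
    two boxes whose volumes add up. The common face is counted in both, at no cost. *)
Lemma measurable_half_space (i : 'I_n.+1) (c : R) :
  measurable ([set x | x 0 i <= c] : set rVm).
Proof.
apply: le_caratheodory_measurable => X.
apply: le_ereal_inf_tmp => _ [F XF <-].
pose F1 k : rV * rV := ((F k).1,
  \row_j if j == i then Num.min ((F k).2 0 i) c else (F k).2 0 j).
pose F2 k : rV * rV :=
  (\row_j (if j == i then Num.max ((F k).1 0 i) c else (F k).1 0 j), (F k).2).
have vol_ge0 ab : (0 <= (box_volume ab : R)%:E)%E.
  by rewrite lee_fin; apply: prodr_ge0 => j _; rewrite le_max lexx.
have -> : (\sum_(k <oo) (box_volume (F k))%:E =
    \sum_(k <oo) (box_volume (F1 k))%:E + \sum_(k <oo) (box_volume (F2 k))%:E)%E.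
  rewrite -nneseriesD//; apply: eq_eseriesr => k _; rewrite -EFinD; congr (_%:E).
  have volE (ab : rV * rV) : box_volume ab = Num.max 0 (ab.2 0 i - ab.1 0 i) *
      \prod_(j | j != i) Num.max 0 (ab.2 0 j - ab.1 0 j) :> R.
    by rewrite /box_volume (bigD1 i).
  rewrite !volE /= !mxE eqxx.
  under [X in _ = _ + _ * X]eq_bigr => j ji do rewrite mxE (negbTE ji).
  under [X in _ = _ * X + _]eq_bigr => j ji do rewrite mxE (negbTE ji).
  rewrite -mulrDl; congr (_ * _).
  (* Thanks to the truncation at 0 the identity also holds for empty boxes and for hyperplanes that
     miss the box. *)
  by rewrite !(maxEle, minEle); do ! case: ifP; lra.
apply: leeD; apply: ereal_inf_lbound.
- exists F1 => // x [Xx /= xc]; have [k _ Fx] := XF _ Xx.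
  exists k => // j; rewrite /F1/= !mxE; have := Fx j.
  by case: eqP => [->|//] /andP[-> h]; rewrite le_min h.
- exists F2 => // x [Xx /= /negP]; rewrite -ltNge => xc.
  have [k _ Fx] := XF _ Xx.
  exists k => // j; rewrite /F2/= !mxE; have := Fx j.
  by case: eqP => [->|//] /andP[h ->]; rewrite ge_max h ltW.
Qed.

Lemma box_eq_bigcap (ab : rV * rV) :
  box ab = \bigcap_(i in [set: 'I_n.+1])
    ([set x : rV | x 0 i <= ab.2 0 i] `&` ~` [set x | x 0 i < ab.1 0 i]).
Proof.
apply/seteqP; split => [x xab i _|x xab i].
  by have /andP[l r] := xab i; split => //=; rewrite ltNge l.
by have [//= r] := xab i I; move=> /negP; rewrite -leNgt => ->.
Qed.

Lemma measurable_box (ab : rV * rV) : measurable (box ab : set rVm).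
Proof.
rewrite box_eq_bigcap; apply: fin_bigcap_measurable; first exact: finite_finset.
move=> i _; apply: measurableI; first exact: measurable_half_space.
apply: measurableC; rewrite [X in measurable X](_ : _ =
    \bigcup_k [set x : rVm | x 0 i <= ab.1 0 i - k.+1%:R^-1]).
  by apply: bigcup_measurable => k _; exact: measurable_half_space.
apply/seteqP; split => x /=; last first.
  by move=> [k _ /=] /le_lt_trans; apply; rewrite gtrBl.
move=> h; have : 0 < ab.1 0 i - x 0 i by rewrite subr_gt0.
move=> /ltr_add_invr -[k]; rewrite add0r => hk; exists k => //=.
by rewrite lerBrDl -lerBrDr ltW.
Qed.

Lemma measurable_open_rV (U : set rV) : open U -> measurable (U : set rVm).
Proof.
move=> oU.
pose cb (qk : 'rV[rat]_n.+1 * nat) : rV * rV :=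
  (\row_i (ratr (qk.1 0 i) - qk.2.+1%:R^-1),
   \row_i (ratr (qk.1 0 i) + qk.2.+1%:R^-1)).
rewrite (_ : U = \bigcup_qk (if `[< box (cb qk) `<=` U >] then box (cb qk)
    else set0)); last first.
  apply/seteqP; split => [x Ux|x [qk _]]; last by case: asboolP => // h /h.
  have /nbhs_ballP[e /= e0 xeU] := open_nbhs_nbhs (conj oU Ux).
  (* A box of radius [d < e / 2] whose rational centre is within [d] of [x] contains [x] and stays
     within [2 d < e] of it. *)
  have : 0 < e / 2 by rewrite divr_gt0.
  move=> /ltr_add_invr -[k]; rewrite add0r; set d := k.+1%:R^-1 => ke.
  have d0 : 0 < d by rewrite invr_gt0.
  have : forall i, exists q : rat, `|x 0 i - ratr q| < d.
    move=> i; have /rat_in_itvoo[q] : x 0 i - d < x 0 i + d by lra.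
    by rewrite in_itv/= => /andP[h1 h2]; exists q; rewrite ltr_norml; lra.
  move=> /choice[q xq].
  have cbE y : box (cb (\row_i q i, k)) y -> forall i, `|y 0 i - ratr (q i)| <= d.
    by move=> yb i; have := yb i; rewrite /= !mxE -/d ler_norml; lra.
  have xb : box (cb (\row_i q i, k)) x.
    by move=> i; rewrite /= !mxE -/d; have := xq i; rewrite ltr_norml; lra.
  exists (\row_i q i, k) => //; case: asboolP => // -[] y /cbE yb.
  apply: xeU; split => // i j; rewrite ord1 /ball/=.
  have := yb j; have := xq j; rewrite ler_norml !ltr_norml; lra.
apply: countable_bigcupT_measurable => [|qk]; first exact: countableP.
by case: ifP => _; [exact: measurable_box|exact: measurable0].
Qed.

Lemma measurable_closed_rV (A : set rV) : closed A -> measurable (A : set rVm).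
Proof.
move=> cA; rewrite -(setCK A); apply: (@measurableC _ rVm).
by apply: measurable_open_rV; exact: closed_openC.
Qed.

Lemma lebesgue_rV_box (ab : rV * rV) : (lebesgue_rV (box ab) < +oo)%E.
Proof.
have box00 : box_volume (0, 0 : rV) = 0 :> R.
  by rewrite /box_volume big_ord_recl/= !mxE subrr maxxx mul0r.
apply: (@le_lt_trans _ _ (\sum_(k <oo)
    (box_volume (if k == 0%N then ab else (0, 0)))%:E)%E).
  apply: ereal_inf_lbound.
  by exists (fun k => if k == 0%N then ab else (0, 0)) => // x xb; exists 0%N.
rewrite (@nneseries_split _ _ 0 1)//; last first.
  by move=> k _; rewrite lee_fin; apply: prodr_ge0 => j _; rewrite le_max lexx.
rewrite eseries0 ?adde0; last by case=> // k _ _; rewrite box00.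
by rewrite big_nat1/= ltry.
Qed.

Lemma lebesgue_rV_bounded (A : set rV) (r : R) :
  (forall x, A x -> `|x| <= r) -> (lebesgue_rV A < +oo)%E.
Proof.
move=> Ar; apply: le_lt_trans (lebesgue_rV_box (const_mx (- r), const_mx r)).
apply: le_lebesgue_outer => x /Ar xr i; rewrite /= !mxE -ler_norml.
exact: le_trans (ler_coord_norm _ _) xr.
Qed.

Lemma lebesgue_rV_set1 : lebesgue_rV [set 0 : rV] = 0%E.
Proof.
apply/eqP; rewrite eq_le lebesgue_outer_ge0 andbT; apply: ereal_inf_lbound.
exists (fun=> (0, 0)).
  by move=> _ ->; exists 0%N => // i; rewrite /= mxE lexx.
apply: eseries0 => k _ _.
by rewrite /box_volume big_ord_recl/= !mxE subrr maxxx mul0r.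
Qed.

Lemma box_volumeZ (l : R) (ab : rV * rV) : 0 <= l ->
  box_volume (l *: ab.1, l *: ab.2) = l ^+ n.+1 * box_volume ab.
Proof.
move=> l0; rewrite /box_volume/=.
have -> : l ^+ n.+1 = \prod_(i < n.+1) l by rewrite prodr_const card_ord.
rewrite -big_split/=.
apply: eq_bigr => i _; rewrite !mxE -mulrBr.
by rewrite -[in LHS](mulr0 l) -maxr_pMr// mulr0.
Qed.

(** Scaling the boxes of a cover gives one inequality for every factor and every set. The other one
    is the same inequality for the factor [l^-1] and the dilated set. *)
Lemma lebesgue_rVZ (l : R) (A : set rV) : 0 < l ->
  lebesgue_rV [set x | A (l^-1 *: x)] = ((l ^+ n.+1)%:E * lebesgue_rV A)%E.
Proof.
have le_l (l' : R) (B : set rV) : 0 < l' ->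
  (lebesgue_rV [set x | B (l'^-1 *: x)] <= (l' ^+ n.+1)%:E * lebesgue_rV B)%E.
  move=> l'0; rewrite /lebesgue_rV/= /lebesgue_outer.
  rewrite -ereal_inf_pZl ?exprn_gt0//; apply: le_ereal_inf_tmp.
  move=> _ [_ [F BF <-] <-]; apply: ereal_inf_lbound.
  exists (fun k => (l' *: (F k).1, l' *: (F k).2)).
    move=> x /BF[k _ Fk]; exists k => // i; have := Fk i.
    by rewrite /= !mxE [_^-1 * _]mulrC ler_pdivlMr// ler_pdivrMr// ![l' * _]mulrC.
  rewrite -nneseriesZl => [|k _].
    by apply: eq_eseriesr => k _; rewrite -EFinM -box_volumeZ ?ltW.
  by rewrite lee_fin; apply: prodr_ge0 => j _; rewrite le_max lexx.
move=> l0; apply/eqP; rewrite eq_le le_l//=.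
have := le_l l^-1 [set x | A (l^-1 *: x)].
rewrite invr_gt0 => /(_ l0) /=.
rewrite (_ : [set x | A _] = A); last first.
  apply/seteqP; split => x /=; by rewrite scalerA mulfV ?scale1r// gt_eqF// invr_gt0.
move=> h; apply: (le_trans (lee_wpmul2l _ h)).
  by rewrite lee_fin exprn_ge0// ltW.
by rewrite muleA -EFinM -exprMn mulfV ?gt_eqF// expr1n mul1e.
Qed.

End lebesgue_rV_theory.

(** * Gradients of strictly convex homogeneous functions *)

Section dot_product.
Context {R : realType} {n : nat}.
Local Notation rV := 'rV[R]_n.+1.
Implicit Types (x y z : rV) (a : R).

Lemma dotpC x y : dotp x y = dotp y x.
Proof. by apply: eq_bigr => i _; rewrite mulrC. Qed.

Lemma dotpDl x y z : dotp (x + y) z = dotp x z + dotp y z.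
Proof. by rewrite -big_split; apply: eq_bigr => i _; rewrite mxE mulrDl. Qed.

Lemma dotpZl a x y : dotp (a *: x) y = a * dotp x y.
Proof. by rewrite mulr_sumr; apply: eq_bigr => i _; rewrite mxE mulrA. Qed.

Lemma dotpNl x y : dotp (- x) y = - dotp x y.
Proof. by rewrite -scaleN1r dotpZl mulN1r. Qed.

Lemma dotpDr x y z : dotp x (y + z) = dotp x y + dotp x z.
Proof. by rewrite dotpC dotpDl ![dotp _ x]dotpC. Qed.

Lemma dotpZr a x y : dotp x (a *: y) = a * dotp x y.
Proof. by rewrite dotpC dotpZl [dotp _ x]dotpC. Qed.

Lemma dotpNr x y : dotp x (- y) = - dotp x y.
Proof. by rewrite dotpC dotpNl [dotp _ x]dotpC. Qed.

Lemma dotp0l y : dotp 0 y = 0.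
Proof. by rewrite -(scale0r y) dotpZl mul0r. Qed.

Lemma dotp_delta x i : dotp x (delta_mx 0 i) = x 0 i.
Proof.
rewrite /dotp (bigD1 i)//= mxE !eqxx mulr1 big1 ?addr0// => j /negbTE ji.
by rewrite mxE ji andbF mulr0.
Qed.

Lemma ler_norm_dotp x y : `|dotp x y| <= (\sum_i `|x 0 i|) * `|y|.
Proof.
apply: le_trans (ler_norm_sum _ _ _) _; rewrite mulr_suml.
by apply: ler_sum => i _; rewrite normrM ler_wpM2l// ler_coord_norm.
Qed.

Lemma dotp_eq0 x : dotp x x <= 0 -> x = 0.
Proof.
have sq i : 0 <= x 0 i * x 0 i by rewrite -expr2 sqr_ge0.
move=> x0; have /eqP : dotp x x = 0.
  by apply/eqP; rewrite eq_le x0 sumr_ge0.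
rewrite psumr_eq0// => /allP h; apply/rowP => i; rewrite mxE.
by have := h i; rewrite mem_index_enum => /(_ isT) /=; rewrite mulf_eq0 orbb => /eqP.
Qed.

Lemma continuous_dotp y : continuous (dotp ^~ y).
Proof.
apply: (@continuous_big _ _ _ _ _ (@add_continuous _) _ _
    (fun i (z : rV) => z 0 i * y 0 i)) => i _.
have cc : continuous (fun z : rV => z 0 i * y 0 i).
  move=> x; apply: (@continuousM R rV (fun z => z 0 i) (fun=> y 0 i) x).
    exact: coord_continuous.
  exact: cst_continuous.
exact: cc.
Qed.

End dot_product.

Lemma convex_setP (R : realType) (n : nat) (A : set 'rV[R]_n.+1) :
  (forall x y t, 0 <= t <= 1 -> A x -> A y -> A (t *: x + (1 - t) *: y)) ->
  convex_set (A : set (convex_lmodType 'rV[R]_n.+1)).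
Proof.
move=> h x y t /set_mem Ax /set_mem Ay; apply/mem_set.
by apply: (h x y t%:num) => //; apply/andP; split.
Qed.

(** Equivalently, [x] maximises [dotp z y - V z] over [z]. Read from the side of [y], the relation
    thus describes [V^*] and inverts the gradient map. *)
Definition subgradient (R : realType) (n : nat) (V : 'rV[R]_n.+1 -> R) x y :=
  forall z, V x + dotp y (z - x) <= V z.

(** * One-sided directional derivatives and uniqueness of subgradients *)

Section directional_derivative.
Context {R : realType} {n : nat}.
Local Notation rV := 'rV[R]_n.+1.
Variable V : rV -> R.
Implicit Types (x y z v : rV).

Lemma derive_dotp_grad x v : differentiable V x -> 'D_v V x = dotp (grad V x) v.
Proof.
move=> dV; rewrite deriveE// {1}(row_sum_delta v) linear_sum/=.
by apply: eq_bigr => i _; rewrite linearZ/= mxE deriveE// mulrC.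
Qed.

Lemma cvg_quotient_grad x v : differentiable V x ->
  (h^-1 * (V (x + h *: v) - V x)) @[h --> 0^'+] --> dotp (grad V x) v.
Proof.
move=> dV; rewrite -derive_dotp_grad//; apply: cvg_dnbhs_at_right.
have : derivable V x v by exact: diff_derivable.
rewrite /derivable /derive => /cvg_ex[l hl].
rewrite (cvg_lim _ hl)//.
by apply: cvg_trans hl; apply: near_eq_cvg; near=> h; rewrite /= [x + _]addrC.
Unshelve. all: by end_near. Qed.

Lemma le_dotp_grad x v c : differentiable V x ->
  (forall t, 0 < t < 1 -> V (x + t *: v) - V x <= t * c) -> dotp (grad V x) v <= c.
Proof.
move=> dV Vc; have := cvg_quotient_grad (v := v) dV; move=> /cvgr_to_le; apply.
near=> h; have h0 : 0 < h by near: h; exact: nbhs_right_gt.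
rewrite mulrC ler_pdivrMr// mulrC; apply: Vc; rewrite h0/=.
by near: h; exact: nbhs_right_lt.
Unshelve. all: by end_near. Qed.

Lemma ge_dotp_grad x v c : differentiable V x ->
  (forall t, 0 < t < 1 -> t * c <= V (x + t *: v) - V x) -> c <= dotp (grad V x) v.
Proof.
move=> dV Vc; have := cvg_quotient_grad (v := v) dV; move=> /cvgr_to_ge; apply.
near=> h; have h0 : 0 < h by near: h; exact: nbhs_right_gt.
rewrite mulrC ler_pdivlMr// mulrC; apply: Vc; rewrite h0/=.
by near: h; exact: nbhs_right_lt.
Unshelve. all: by end_near. Qed.

(** In the direction [v = y - grad V x] the subgradient inequality bounds the derivative
    [dotp (grad V x) v] from below by [dotp y v], so [dotp v v <= 0]. *)
Lemma subgradient_unique x y : differentiable V x -> subgradient V x y -> y = grad V x.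
Proof.
move=> dV xy; apply/eqP; rewrite -subr_eq0; apply/eqP/dotp_eq0.
rewrite dotpDl dotpNl subr_le0; apply: ge_dotp_grad => // t _.
by have := xy (x + t *: (y - grad V x)); rewrite addrAC subrr add0r dotpZr; lra.
Qed.

End directional_derivative.

Section strictly_convex_homogeneous.
Context {R : realType} {n : nat}.
Local Notation rV := 'rV[R]_n.+1.
Variables (p : R) (V : rV -> R).
Hypotheses (p1 : 1 < p) (evenV : even_fun V) (convV : strictly_convex V)
  (homV : homogeneous p V) (C2V : C2 V).
Implicit Types (x y z v : rV).

Let diffV x : differentiable V x. Proof. by case: C2V. Qed.

Let contV : continuous V.
Proof. by move=> x; exact: differentiable_continuous. Qed.

Lemma continuous_grad : continuous (grad V).
Proof. by case: C2V => _ dg _ x; exact: differentiable_continuous. Qed.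

Let p0 : 0 < p. Proof. exact: lt_trans ltr01 p1. Qed.

Lemma homogeneous0 : V 0 = 0.
Proof. by rewrite -(scale0r 0) homV// powR0 ?mul0r// gt_eqF. Qed.

Lemma strictly_convex_le x y t : 0 <= t <= 1 ->
  V (t *: x + (1 - t) *: y) <= t * V x + (1 - t) * V y.
Proof.
move=> /andP[t0 t1]; have [->|xy] := eqVneq x y.
  by rewrite -scalerDl -mulrDl addrC subrK scale1r mul1r.
have [->|tn0] := eqVneq t 0; first by rewrite !scale0r !mul0r subr0 scale1r mul1r !add0r.
have [->|tn1] := eqVneq t 1; first by rewrite subrr !scale0r !mul0r scale1r mul1r !addr0.
by apply/ltW/convV => //; rewrite !lt_neqAle eq_sym tn0 t0 tn1 t1.
Qed.

(** The origin is the midpoint of [x] and [- x], where [V] takes equal values. *)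
Lemma homogeneous_gt0 x : x != 0 -> 0 < V x.
Proof.
move=> x0; have xNx : x != - x.
  apply: contra x0 => /eqP xNx; apply/eqP/rowP => i.
  by have := congr1 (fun z : rV => z 0 i) xNx; rewrite !mxE; lra.
have /(convV xNx) : 0 < (2^-1 : R) < 1 by lra.
rewrite evenV (_ : 1 - 2^-1 = 2^-1 :> R); last lra.
by rewrite scalerN subrr homogeneous0; lra.
Qed.

Lemma subgradient_grad x : subgradient V x (grad V x).
Proof.
move=> z; rewrite -lerBrDl; apply: le_dotp_grad => // t /andP[t0 t1].
have -> : x + t *: (z - x) = t *: z + (1 - t) *: x.
  by rewrite scalerBr scalerBl scale1r addrCA.
have /(strictly_convex_le z x) : 0 <= t <= 1 by rewrite !ltW.
lra.
Qed.

(** Add the two inequalities at the midpoint of [x] and [x']: the linear terms cancel, which leaves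
    the reverse of strict midpoint convexity. *)
Lemma subgradient_inj x x' y : subgradient V x y -> subgradient V x' y -> x = x'.
Proof.
move=> xy x'y; apply/eqP; apply: contraT => xx'.
have /(convV xx') : 0 < (2^-1 : R) < 1 by lra.
rewrite (_ : 1 - 2^-1 = 2^-1 :> R); last lra.
set m := _ + _; have := xy m; have := x'y m.
have mE : m - x' = - (m - x).
  rewrite /m opprB; apply/rowP => i; rewrite !mxE; lra.
rewrite mE dotpNr; lra.
Qed.

(** The constant is the minimum of [V] on the compact unit sphere, carried to all of space by
    homogeneity. *)
Lemma coercive : exists2 c, 0 < c & forall x, c * `|x| `^ p <= V x.
Proof.
pose S : set rV := [set x | `|x| = 1].
have cS : compact S.
  apply: bounded_closed_compact.
    by exists 1; split => // M M1 x /= ->; exact: ltW.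
  have -> : S = (fun x : rV => `|x|) @^-1` [set 1 : R] by [].
  apply: preimage_closed; last exact: closed_eq.
  by move=> x _; exact: norm_continuous.
have normalize x : x != 0 -> S (`|x|^-1 *: x).
  move=> x0; rewrite /S/= normrZ normfV normr_id mulVf// normr_eq0//.
have S0 : S !=set0.
  exists (`|const_mx 1 : rV|^-1 *: const_mx 1); apply: normalize.
  by apply/eqP => /rowP /(_ 0); rewrite !mxE; apply/eqP; rewrite oner_eq0.
have [|x0 /set_mem x0S x0min] := EVT_min_rV S0 cS (f := V).
  exact: continuous_subspaceT.
exists (V x0).
  apply: homogeneous_gt0; apply/eqP => x00; move: x0S.
  by rewrite /S/= x00 normr0 => /esym/eqP; rewrite oner_eq0.
move=> x; have [->|xn0] := eqVneq x 0.
  by rewrite normr0 powR0 ?gt_eqF// mulr0 homogeneous0.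
rewrite [in leRHS](_ : x = `|x| *: (`|x|^-1 *: x)); last first.
  by rewrite scalerA mulfV ?scale1r// normr_eq0.
rewrite homV// mulrC ler_wpM2l ?powR_ge0//; apply: x0min.
by apply/mem_set/normalize.
Qed.

(** The point sought minimises [V z - dotp z y]. Consequently [V^*] is finite everywhere, and the
    [fine] in [legendreR] loses nothing. *)
Lemma subgradient_surj y : exists x, subgradient V x y.
Proof.
have [c c0 cV] := coercive.
pose D := \sum_i `|y 0 i|; have D0 : 0 <= D by exact: sumr_ge0.
(* The radius beyond which [c |z|^p] dominates [D |z|]: it solves [c r^(p-1) = D]. Outside the ball
   [F] is therefore at least [F 0 = 0]. *)
pose r := (D / c) `^ (p - 1)^-1.
have rD : r `^ (p - 1) = D / c.
  rewrite -powRrM mulVf ?powRr1//; last by rewrite gt_eqF// subr_gt0.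
  by rewrite divr_ge0// ltW.
pose F x := V x - dotp x y.
have F0 : F 0 = 0 by rewrite /F homogeneous0 dotp0l subr0.
have cF : continuous F.
  move=> x; apply: (@continuousB _ _ _ V (dotp ^~ y)); first exact: contV.
  exact: continuous_dotp.
pose B : set rV := [set x | `|x| <= r].
have r0 : 0 <= r by exact: powR_ge0.
have B0 : B 0 by rewrite /B/= normr0.
have cB : compact B.
  apply: bounded_closed_compact.
    by exists r; split => [|M rM x /= h]; [exact: num_real|exact: le_trans h (ltW rM)].
  have -> : B = (fun x : rV => `|x|) @^-1` [set t : R | t <= r] by [].
  apply: preimage_closed; last exact: closed_le.
  by move=> x _; exact: norm_continuous.
have [|x0 /set_mem x0B x0min] := EVT_min_rV (ex_intro _ _ B0) cB (f := F).
  exact: continuous_subspaceT.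
exists x0 => z; suff : F x0 <= F z.
  by rewrite /F dotpC [dotp z _]dotpC dotpDr dotpNr; lra.
have [zr|rz] := leP `|z| r; first by apply: x0min; exact/mem_set.
apply: (@le_trans _ _ (F 0)); first by apply: x0min; exact/mem_set.
rewrite F0 subr_ge0; apply: (@le_trans _ _ (c * `|z| `^ p)); last exact: cV.
apply: (@le_trans _ _ (D * `|z|)).
  by rewrite dotpC; apply: le_trans (ler_norm _) (ler_norm_dotp _ _).
have -> : p = (p - 1) + 1 by lra.
rewrite powRD; last by apply/implyP => /eqP; lra.
rewrite powRr1// mulrA ler_wpM2r// mulrC -ler_pdivrMr// -rD.
apply: ge0_ler_powR; rewrite ?nnegrE//; last exact: ltW.
by rewrite subr_ge0 ltW.
Qed.

Lemma legendre_subgradient x y : subgradient V x y ->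
  legendre (EFin \o V) y = (dotp x y - V x)%:E.
Proof.
move=> xy; apply/eqP; rewrite eq_le; apply/andP; split.
  apply: ge_ereal_sup => _ [z _ <-] /=; rewrite -EFinB lee_fin.
  by have := xy z; rewrite dotpDr dotpNr ![dotp y _]dotpC; lra.
by apply: ereal_sup_ubound; exists x.
Qed.

Lemma legendreR_subgradient x y : subgradient V x y ->
  legendreR V y = dotp x y - V x.
Proof. by move=> xy; rewrite /legendreR (legendre_subgradient xy). Qed.

(** Continuity of the inverse gradient map at [y]. The function [F z = V z - dotp z y] has the
    unique minimiser [x], so it exceeds [F x] by a positive gap on the sphere of radius [e]. By
    convexity the excess grows at least linearly beyond the sphere, while the slope [y' - y] of [F]
    at [x'] bounds it from above. *)
Lemma subgradient_near x y e : 0 < e -> subgradient V x y ->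
  exists2 d, 0 < d & forall x' y', subgradient V x' y' ->
    \sum_i `|(y' - y) 0 i| < d -> `|x' - x| < e.
Proof.
move=> e0 xy; pose F z := V z - dotp z y.
have cF : continuous F.
  move=> z; apply: (@continuousB _ _ _ V (dotp ^~ y)); first exact: contV.
  exact: continuous_dotp.
have Fmin z : F x <= F z.
  by have := xy z; rewrite /F dotpDr dotpNr ![dotp y _]dotpC; lra.
pose S : set rV := [set z | `|z - x| = e].
have cS : compact S.
  apply: bounded_closed_compact.
    exists (`|x| + e); split; first exact: num_real.
    move=> M M1 z /= ze; apply: le_trans (ltW M1).
    by rewrite -[z](subrK x) addrC -ze; exact: ler_normD.
  have -> : S = (fun z : rV => `|z - x|) @^-1` [set e] by [].
  apply: preimage_closed; last exact: closed_eq.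
  move=> z _; apply: (@continuous_comp _ _ _ (fun z : rV => z - x)
      (fun z : rV => `|z|)); last exact: norm_continuous.
  by apply: (@continuousB _ _ _ id (cst x)); [exact: cvg_id|exact: cst_continuous].
have towards w : w != x -> S (x + (e / `|w - x|) *: (w - x)).
  move=> wx; rewrite /S/= addrAC subrr add0r normrZ normrM normfV normr_id.
  by rewrite -mulrA mulVf ?normr_eq0 ?subr_eq0// mulr1 gtr0_norm.
have S0 : S !=set0.
  exists (x + (e / `|const_mx 1 + x - x|) *: (const_mx 1 + x - x)).
  apply: towards; rewrite -subr_eq0 addrK.
  by apply/eqP => /rowP /(_ 0); rewrite !mxE; apply/eqP; rewrite oner_eq0.
have [|z0 /set_mem z0S z0min] := EVT_min_rV S0 cS (f := F).
  exact: continuous_subspaceT.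
have d0 : 0 < F z0 - F x.
  rewrite subr_gt0 lt_neqAle Fmin andbT; apply/eqP => Fx.
  have : subgradient V z0 y.
    move=> z; have := Fmin z; rewrite Fx /F dotpDr dotpNr ![dotp y _]dotpC; lra.
  move=> /(subgradient_inj xy) xz0; move: z0S.
  by rewrite /S/= -xz0 subrr normr0; apply/eqP; rewrite lt_eqF.
exists ((F z0 - F x) / e); first by rewrite divr_gt0.
move=> w y' wy'; rewrite !ltNge; apply: contra => ew.
have wx0 : 0 < `|w - x| by exact: lt_le_trans ew.
have wx : w != x by rewrite -subr_eq0 -normr_gt0.
have : F z0 <= F (x + (e / `|w - x|) *: (w - x)).
  by apply: z0min; exact/mem_set/towards.
set t := e / _; have t01 : 0 <= t <= 1.
  apply/andP; split; first by rewrite /t divr_ge0// ltW.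
  by rewrite /t ler_pdivrMr// mul1r.
have -> : x + t *: (w - x) = t *: w + (1 - t) *: x.
  by rewrite scalerBr scalerBl scale1r addrCA.
move=> z0t; have Ft : F z0 - F x <= t * (F w - F x).
  have := strictly_convex_le w x t01; move: z0t; rewrite /F dotpDl !dotpZl; lra.
(* The subgradient [y'] at [w] is tested at [x]. The l1 norm of [y' - y] appears as the dual of the
   sup norm. *)
have Fw : F w - F x <= (\sum_i `|(y' - y) 0 i|) * `|w - x|.
  apply: le_trans (ler_norm_dotp _ _); apply: le_trans (ler_norm _).
  have := wy' x; rewrite /F dotpDl dotpNl !dotpDr !dotpNr.
  rewrite ![dotp _ x]dotpC ![dotp _ w]dotpC; lra.
rewrite ler_pdivrMr// (le_trans Ft)//.
have t0 : 0 <= t by case/andP: t01.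
apply: le_trans (ler_wpM2l t0 Fw) _.
by rewrite mulrCA /t divfK// gt_eqF.
Qed.

(** If [w] is the point whose subgradient is [grad V x + h e_i], the two subgradient inequalities
    place the increment of [V^*] between [h x_i] and [h w_i], for either sign of [h]; and [w] tends
    to [x] by [subgradient_near]. *)
Lemma grad_legendreR x : grad (legendreR V) (grad V x) = x.
Proof.
set y := grad V x; have xy : subgradient V x y by exact: subgradient_grad.
apply/rowP => i; rewrite mxE; apply: cvg_lim => //.
apply/cvgrPdist_lt => e e0.
have [d d0 hd] := subgradient_near e0 xy.
near=> h.
have h0 : h != 0 by near: h; exact: nbhs_dnbhs_neq.
have [w wy'] := subgradient_surj (y + h *: delta_mx 0 i).
rewrite /= [_ + y]addrC (legendreR_subgradient wy') (legendreR_subgradient xy).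
have hxw : `|w - x| < e.
  apply: (hd _ _ wy'); rewrite addrAC subrr add0r (bigD1 i)//= big1 ?addr0.
    rewrite !mxE !eqxx mulr1; near: h; apply: dnbhs0_lt => //.
  by move=> j ji; rewrite !mxE (negbTE ji) andbF mulr0 normr0.
have := wy' x; have := xy w.
rewrite !dotpDr !dotpNr !dotpDl !dotpZl !dotpZr ![dotp (delta_mx _ _) _]dotpC !dotp_delta.
rewrite ![dotp _ y]dotpC.
move=> h1 h2; set q := (X in h^-1 *: X).
have q1 : h * x 0 i <= q by rewrite /q; lra.
have q2 : q <= h * w 0 i by rewrite /q; lra.
clearbody q.
apply: le_lt_trans hxw; apply: le_trans (ler_coord_norm _ i); rewrite !mxE.
have -> : `|x 0 i - h^-1 *: q| = `|h|^-1 * `|h * x 0 i - q|.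
  by rewrite -normfV -normrM mulrBr mulrA mulVf// mul1r.
rewrite ler_pdivrMl ?normr_gt0// -normrM [h * (_ - _)]mulrBr.
rewrite distrC [leLHS]ger0_norm ?subr_ge0//.
by apply: le_trans (ler_norm _); rewrite lerD2r.
Unshelve. all: by end_near. Qed.

Lemma image_grad_legendreR (A : set rV) :
  grad (legendreR V) @` A = [set x | A (grad V x)].
Proof.
apply/seteqP; split => [_ [y Ay <-]|x Ax] /=; last first.
  by exists (grad V x) => //; exact: grad_legendreR.
have [x xy] := subgradient_surj y.
by move: Ay; rewrite (subgradient_unique (diffV x) xy) grad_legendreR.
Qed.

(** Multiplying the subgradient inequality at [x], tested at [l^-1 z], by [l^p] shows that the
    right-hand side is a subgradient at [l x]; uniqueness concludes. *)
Lemma gradZ l x : 0 < l -> grad V (l *: x) = l `^ (p - 1) *: grad V x.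
Proof.
move=> l0; apply/esym/subgradient_unique => // z.
have := subgradient_grad x (l^-1 *: z).
have l0' := ltW l0; have li0 : 0 <= l^-1 by rewrite invr_ge0.
rewrite !homV// -(ler_pM2l (powR_gt0 p l0)) mulrA -powRM//.
rewrite mulfV ?gt_eqF// powR1 mul1r mulrDr dotpZl.
apply: le_trans; rewrite lerD2l.
rewrite (_ : z - l *: x = l *: (l^-1 *: z - x)); last first.
  by rewrite scalerBr scalerA mulfV ?scale1r// gt_eqF.
rewrite dotpZr mulrA.
have -> // : l `^ (p - 1) * l = l `^ p.
by rewrite -[X in _ * X]powRr1// -powRD ?subrK// gt_eqF ?implybT.
Qed.

(** Along the ray through [x] the subgradient inequality says [f s >= 0 = f 1], so the derivative of
    [f] vanishes at 1. *)
Lemma dotp_gradE x : dotp (grad V x) x = p * V x.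
Proof.
pose f (s : R) := s `^ p * V x - V x - (s - 1) * dotp (grad V x) x.
have df (s : R) : 0 < s -> is_derive s 1 f (p * s `^ (p - 1) * V x - dotp (grad V x) x).
  move=> s0; have dp := is_derive1_powR p s0.
  rewrite /f; apply: is_derive_eq.
  by rewrite /GRing.scale/=; ring.
have : is_derive (1 : R) 1 f 0.
  apply: (@derive1_at_min _ f 0 2) => //.
  - by move=> t; rewrite in_itv/= => /andP[t0 _]; have [] := df _ t0.
  - by rewrite in_itv/=; lra.
  - move=> t; rewrite in_itv/= => /andP[t0 _].
    rewrite /f powR1 mul1r !subrr mul0r subr0.
    have := subgradient_grad x (t *: x); rewrite homV; last exact: ltW.
    by rewrite dotpDr dotpNr dotpZr; lra.
have := df _ ltr01; move=> [_ d1] [_]; rewrite d1 powR1 => /eqP.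
by rewrite mulr1 subr_eq0 => /eqP.
Qed.

Lemma sublevel_bounded a : exists r, forall x, V x <= a -> `|x| <= r.
Proof.
have [c c0 cV] := coercive; exists ((`|a| / c) `^ p^-1) => x xa.
have : `|x| `^ p <= `|a| / c.
  rewrite ler_pdivlMr// mulrC (le_trans (cV _))// (le_trans xa)//.
  exact: ler_norm.
rewrite -[in X in _ -> X](powRr1 (normr_ge0 x)) -(mulfV (lt0r_neq0 p0)) powRrM.
by move=> h; apply: ge0_ler_powR => //; rewrite ?nnegrE ?powR_ge0//;
  [rewrite invr_ge0 ltW|rewrite divr_ge0// ltW].
Qed.

Lemma sublevel_convex_body a : 0 < a -> convex_body [set x | V x <= a].
Proof.
move=> a0; split.
- apply: bounded_closed_compact.
    have [r hr] := sublevel_bounded a; exists r; split; first exact: num_real.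
    by move=> M rM x /hr h; exact: le_trans h (ltW rM).
  have -> : [set x | V x <= a] = V @^-1` [set t : R | t <= a] by [].
  by apply: preimage_closed; [move=> x _; exact: contV|exact: closed_le].
- apply: convex_setP => x y t t01 /= xa ya.
  apply: le_trans (strictly_convex_le _ _ t01) _; case/andP: t01 => t0 t1.
  have : (1 - t) * V y <= (1 - t) * a by rewrite ler_wpM2l// subr_ge0.
  have : t * V x <= t * a by rewrite ler_wpM2l.
  lra.
- exists 0; rewrite /interior/=; near=> x; apply/ltW; near: x.
  by apply: (cvgr_lt _ (@contV 0)); rewrite homogeneous0.
Unshelve. all: by end_near. Qed.

End strictly_convex_homogeneous.

(** * Legendre transforms and the layer-cake formula *)

Section legendre_theory.
Context {R : realType} {n : nat}.
Local Notation rV := 'rV[R]_n.+1.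
Implicit Types (F : rV -> \bar R) (x y z : rV).
Local Open Scope ereal_scope.

Lemma legendre_leP F y (s : \bar R) :
  legendre F y <= s <-> forall z, (dotp z y)%:E - F z <= s.
Proof.
split=> [Fs z|Fs]; last by apply: ge_ereal_sup => _ [z _ <-].
by apply: le_trans Fs; apply: ereal_sup_ubound; exists z.
Qed.

(** An intersection of half-spaces, with the whole space where [F z = +oo] and the empty set where
    [F z = -oo]. This is the source of measurability for every Legendre transform below. *)
Lemma closed_legendre F (s : R) : closed [set y | legendre F y <= s%:E].
Proof.
rewrite [X in closed X](_ : _ =
    \bigcap_(z in setT) [set y | (dotp z y)%:E - F z <= s%:E]); last first.
  apply/seteqP; split => y /=; rewrite legendre_leP => h z; [move=> _; exact: h|exact: h].
apply: closed_bigI => z _; case: (F z) => [r| |].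
- rewrite [X in closed X](_ : _ = (dotp ^~ z) @^-1` [set t : R | (t <= s + r)%R]).
    by apply: preimage_closed; [move=> y _; exact: continuous_dotp|exact: closed_le].
  by apply/seteqP; split => y /=; rewrite -EFinB lee_fin dotpC lerBlDr.
- rewrite [X in closed X](_ : _ = setT); first exact: closedT.
  by apply/seteqP; split => y //= _; rewrite leNye.
- rewrite [X in closed X](_ : _ = set0); first exact: closed0.
  by apply/seteqP; split => y //=.
Qed.

Lemma legendre_even F : even_fun F -> even_fun (legendre F).
Proof.
move=> evenF.
have le y : legendre F (- y) <= legendre F y.
  apply/legendre_leP => z; apply: ereal_sup_ubound.
  by exists (- z)%R => //=; rewrite evenF dotpNl dotpNr.
by move=> y; apply/eqP; rewrite eq_le le/= -{1}(opprK y) le.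
Qed.

Lemma legendre_biconjugate_le F x : (forall x, -oo < F x) ->
  legendre (legendre F) x <= F x.
Proof.
move=> FNy; apply/legendre_leP => z.
have : (dotp x z)%:E - F x <= legendre F z by apply: ereal_sup_ubound; exists x.
rewrite dotpC; have := FNy x; case: (F x) => [r| |] //= _; last by rewrite leey.
case: (legendre F z) => [t| |] //=; last by rewrite addeNy leNye.
by rewrite -!EFinB !lee_fin; lra.
Qed.

Lemma fenchel_young F x y (s t : R) : legendre (legendre F) x <= s%:E ->
  legendre F y <= t%:E -> (dotp x y <= s + t)%R.
Proof.
move=> /legendre_leP/(_ y); rewrite dotpC; case: (legendre F y) => [r| |] //=.
by rewrite -!EFinB !lee_fin; lra.
Qed.

Lemma legendre_econvex F : (forall y, -oo < legendre F y) -> econvex (legendre F).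
Proof.
move=> FNy; split => // x y t /andP[t0 t1]; apply/legendre_leP => z.
have := FNy x; have := FNy y.
have : (dotp z x)%:E - F z <= legendre F x by apply: ereal_sup_ubound; exists z.
have : (dotp z y)%:E - F z <= legendre F y by apply: ereal_sup_ubound; exists z.
rewrite dotpDr !dotpZr.
(* The end points are treated apart because there 0 may multiply an infinite value; for [0 < t < 1]
   an infinite value makes the right-hand side [+oo]. *)
have [->|tn0] := eqVneq t 0%R.
  by rewrite subr0 !mul0r mul0e !mul1r mul1e add0r add0e.
have [->|tn1] := eqVneq t 1%R.
  by rewrite subrr !mul0r mul0e !mul1r mul1e addr0 adde0.
have t0' : (0 < t)%R by rewrite lt_neqAle eq_sym tn0.
have t1' : (0 < 1 - t)%R by rewrite subr_gt0 lt_neqAle tn1.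
case: (legendre F x) => [a| |] //; case: (legendre F y) => [b| |] //.
- case: (F z) => [c| |] //=; rewrite -!EFinM -?EFinD -?EFinB ?lee_fin; last first.
    by move=> *; rewrite addeNy leNye.
  move=> h1 h2 _ _.
  have : ((1 - t) * (dotp z y - c) <= (1 - t) * b)%R by rewrite ler_wpM2l// ltW.
  have : (t * (dotp z x - c) <= t * a)%R by rewrite ler_wpM2l// ltW.
  lra.
- by move=> _ _ _ _; rewrite gt0_muley ?lte_fin// -EFinM addey// leey.
- by move=> _ _ _ _; rewrite gt0_muley ?lte_fin// -EFinM addye// leey.
- by move=> _ _ _ _; rewrite !gt0_muley ?lte_fin// addye// leey.
Qed.

End legendre_theory.

Section lebesgue_rV_sigma_finite.
Context {R : realType} {n : nat}.

Let sigma_finite_lebesgue_rV : sigma_finite setT (@lebesgue_rV R n).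
Proof.
exists (fun k => box (const_mx (- k%:R), const_mx k%:R)).
  apply/esym/seteqP; split => // x _.
  exists (Num.truncn `|x|).+1 => // i /=; rewrite !mxE -ler_norml.
  by apply: le_trans (ler_coord_norm _ _) _; apply/ltW/truncnS_gt.
by move=> k; split; [exact: measurable_box|exact: lebesgue_rV_box].
Qed.

HB.instance Definition _ := Measure_isSigmaFinite.Build _ _ _ (@lebesgue_rV R n)
  sigma_finite_lebesgue_rV.

End lebesgue_rV_sigma_finite.

(** * The layer-cake formula for exp(-F) *)

Lemma integral_expRN_itv (R : realType) (a : R) :
  (\int[lebesgue_measure]_(s in `[a, +oo[) (expR (- s))%:E = (expR (- a))%:E)%E.
Proof.
rewrite (@ge0_continuous_FTC2y _ _ (fun s => - expR (- s)) a 0).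
- by rewrite -EFinN opprK -EFinD add0r.
- by move=> s _; exact: expR_ge0.
- by apply: continuous_subspaceT => s; apply: continuous_comp;
    [exact: opp_continuous|exact: continuous_expR].
- by rewrite -oppr0; apply: cvgN; exact: cvgr_expR.
- by move=> s _; exact: ex_derive.
- by apply: cvg_at_right_filter; apply: cvgN; apply: continuous_comp;
    [exact: opp_continuous|exact: continuous_expR].
- move=> s _; rewrite derive1E; apply: derive_val; apply: is_derive_eq.
  by rewrite mulrN1 opprK.
Qed.

Section layer_cake.
Local Open Scope ereal_scope.
Context {R : realType}.
Local Notation mu := (@lebesgue_measure R).

Lemma expeRN_integral (a : \bar R) :
  expeR (- a) = \int[mu]_s ((expR (- s))%:E * (\1_[set s : R | (a <= s%:E)%E] s)%:E).
Proof.
have mexp (D : set R) : measurable_fun D (fun s => (expR (- s))%:E).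
  by apply/measurable_EFinP; apply: measurable_funS (@measurableT _ _) _ _ => //;
    apply: measurableT_comp => //.
transitivity (\int[mu]_(s in [set s : R | a <= s%:E]) (expR (- s))%:E); last first.
  by rewrite integral_mkcond epatch_indic.
case: a => [r| |] /=.
- rewrite -integral_expRN_itv; congr (integral _ _ _).
  by apply/seteqP; split => s /=; rewrite in_itv/= andbT lee_fin.
- rewrite [X in integral _ X _](_ : _ = set0) ?integral_set0//.
  by apply/seteqP; split => s.
- rewrite [X in integral _ X _](_ : _ = setT); last first.
    by apply/seteqP; split => // s _ /=; rewrite leNye.
  (* For [a = -oo] the integral runs over the whole line. It exceeds every [A > 0], since the
     half-line starting at [- ln A] already contributes [A]. *)
  apply/esym/eqyP => A A0.
  apply: (@le_trans _ _ (\int[mu]_(s in `[(- ln A)%R, +oo[) (expR (- s))%:E)).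
    by rewrite integral_expRN_itv opprK lnK.
  by apply: ge0_subset_integral => //; exact: mexp.
Qed.

Lemma integral_expeRN d (T : measurableType d)
    (m : {sigma_finite_measure set T -> \bar R}) (F : T -> \bar R) :
  measurable_fun [set: T] F ->
  \int[m]_x expeR (- F x) = \int[mu]_s ((expR (- s))%:E * m [set x | F x <= s%:E]).
Proof.
move=> mF.
pose f (xs : T * measurableTypeR R) :=
  ((expR (- xs.2))%:E * (\1_[set xs : T * measurableTypeR R | (F xs.1 <= xs.2%:E)%E] xs)%:E).
have mset : measurable [set xs : T * measurableTypeR R | F xs.1 <= xs.2%:E].
  have := @measurable_lee _ (T * measurableTypeR R)%type R setT measurableT
    (F \o fst) (EFin \o snd).
  by rewrite setTI; apply; [exact: measurableT_comp|exact/measurable_EFinP].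
have mf : measurable_fun setT f.
  apply: emeasurable_funM; apply/measurable_EFinP => //.
  apply: measurableT_comp => //; exact: measurableT_comp.
transitivity (\int[m]_x \int[mu]_s f (x, s)).
  by apply: eq_integral => x _; exact: expeRN_integral.
rewrite (fubini_tonelli (m1 := m) (m2 := mu) f mf); last by move=> xs; rewrite mule_ge0// lee_fin ?expR_ge0.
apply: eq_integral => s _.
have mFs : measurable [set x | F x <= s%:E].
  by rewrite -[X in measurable X]setTI; exact: emeasurable_fun_infty_c.
rewrite /f/= ge0_integralZl_EFin ?expR_ge0//; last first.
  by apply/measurable_EFinP; exact: measurable_indic.
by rewrite integral_indic// setIT.
Qed.

Lemma measurable_sublevel_measure d (T : measurableType d)
    (m : {sigma_finite_measure set T -> \bar R}) (F : T -> \bar R) :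
  measurable_fun [set: T] F ->
  measurable_fun [set: R] (fun s : R => m [set x | F x <= s%:E]).
Proof.
move=> mF.
have mset : measurable [set xs : T * R | F xs.1 <= xs.2%:E].
  have := @measurable_lee _ (T * R)%type R setT measurableT (F \o fst) (EFin \o snd).
  by rewrite setTI; apply; [exact: measurableT_comp|exact/measurable_EFinP].
have := measurable_fun_ysection m mset; congr (measurable_fun _ _).
by apply/funext => u /=; congr (m _); apply/seteqP; split => x; rewrite /ysection/= inE.
Qed.

End layer_cake.

Lemma measurable_closed_sublevel (R : realType) (n : nat) (F : 'rV[R]_n.+1 -> \bar R) :
  (forall s : R, closed [set x | (F x <= s%:E)%E]) ->
  measurable_fun [set: caratheodory_type (@lebesgue_outer R n)] F.
Proof.
move=> cF; apply: (measurability _ (ErealGenOInfty.measurableE R)).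
move=> _ [_ [r ->] <-]; rewrite setTI.
rewrite [X in measurable X](_ : _ = ~` [set x | (F x <= r%:E)%E]).
  by apply: measurableC; exact: measurable_closed_rV.
by apply/seteqP; split => x /=; rewrite in_itv/= andbT ltNge => /negP.
Qed.

(** The integral of a nonnegative function is the supremum of the integrals of the simple functions
    below it. This is what allows [Phi] to be replaced by its biconjugate. *)
Lemma ge0_le_integral_nonmeasurable d (T : measurableType d) (R : realType)
    (m : {measure set T -> \bar R}) (f g : T -> \bar R) :
  (forall x, (0 <= f x)%E) -> (forall x, (f x <= g x)%E) ->
  (\int[m]_x f x <= \int[m]_x g x)%E.
Proof.
move=> f0 fg; have g0 x : (0 <= g x)%E by exact: le_trans (fg x).
rewrite !ge0_integralE//; apply: le_ereal_sup => _ [h hf <-]; exists h => // x.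
by apply: le_trans (hf x) _; rewrite !patch_setT.
Qed.


(** * The one-dimensional Prekopa-Leindler inequality *)

Lemma indic_eq (T U : Type) (R : pzRingType) (A : set T) (B : set U) x y :
  (A x <-> B y) -> \1_A x = \1_B y :> R.
Proof.
move=> AB; rewrite !indicE; have [Ax|nAx] := pselect (A x).
  by rewrite !mem_set//; exact/AB.
by rewrite !memNset// => By; exact/nAx/AB.
Qed.

Lemma measurable_lt_set d (T : measurableType d) (R : realType) (f g : T -> R) :
  measurable_fun [set: T] f -> measurable_fun [set: T] g ->
  measurable [set x | f x < g x].
Proof.
move=> mf mg.
rewrite [X in measurable X](_ : _ = (fun x => f x < g x) @^-1` [set true])//.
by rewrite -[X in measurable X]setTI; exact: measurable_fun_ltr.
Qed.

(** Multiplication on [0, +oo] is discontinuous at (0, +oo), so the limit is not immediate. The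
    bound is assumed for independent indices, which permits the limit in [i] at fixed [j], and only
    then the limit in [j]. *)
Lemma le_mul_poweR_lim (R : realType) (q : R) (u v : nat -> \bar R) (x y d : \bar R) :
  0 < q -> (forall i, (0 <= u i)%E) -> (forall i, (0 <= v i)%E) ->
  u i @[i --> \oo] --> x -> v i @[i --> \oo] --> y ->
  (forall i j, (u i * v j `^ q <= d)%E) -> (x * y `^ q <= d)%E.
Proof.
move=> q0 u0 v0 ux vy uvd.
have x0 : (0 <= x)%E by apply: (cvge_to_ge ux); near=> i; exact: u0.
have y0 : (0 <= y)%E by apply: (cvge_to_ge vy); near=> i; exact: v0.
have [->|xn0] := eqVneq x 0%E; first by rewrite mul0e (le_trans _ (uvd 0%N 0%N))// mule_ge0// poweR_ge0.
have [->|yn0] := eqVneq y 0%E.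
  by rewrite poweR0r ?gt_eqF// mule0 (le_trans _ (uvd 0%N 0%N))// mule_ge0// poweR_ge0.
have xp : (0 < x)%E by rewrite lt_def xn0.
have yp : (0 < y)%E by rewrite lt_def yn0.
case: d uvd => [d| |] uvd; last 2 first.
- by rewrite leey.
- by have := le_trans (mule_ge0 (u0 0%N) (poweR_ge0 (v 0%N) q)) (uvd 0%N 0%N).
have xvd j : (x * v j `^ q <= d%:E)%E.
  have [vfin|] := boolP ((v j `^ q)%E \is a fin_num).
    by apply: (cvge_to_le (cvgeZr vfin ux)); near=> i; exact: uvd.
  rewrite ge0_fin_numE ?poweR_ge0// -leNgt leye_eq => /eqP vy'.
  (* An infinite [v j] multiplied by a positive [u i] would violate the finite bound. *)
  have [i ui] : exists i, (0 < u i)%E.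
    apply: contrapT => un; move: xp; rewrite ltNge => /negP; apply.
    apply: (cvge_to_le ux); near=> i.
    by rewrite leNgt; apply/negP => ui; apply: un; exists i.
  have := uvd i j.
  by rewrite vy' gt0_muley// leye_eq.
(* Were [x] infinite, the bound would force every [v j] to vanish, against [0 < y]. *)
have xfin : x \is a fin_num.
  rewrite ge0_fin_numE//; rewrite ltNge leye_eq; apply/negP => /eqP xy.
  have vj j : v j = 0%E.
    apply/eqP; apply: contraT => vj0; have := xvd j.
    by rewrite xy gt0_mulye ?leye_eq// poweR_gt0// lt_def vj0 v0.
  have : (y <= 0)%E by apply: (cvge_to_le vy); near=> j; rewrite vj.
  by rewrite leNgt yp.
move: xp xvd; rewrite -(fineK xfin) lte_fin => xp xvd.
set r := fine x in xp xvd *.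
have d0 : 0 <= d by rewrite -lee_fin (le_trans _ (xvd 0%N))// mule_ge0 ?lee_fin ?(ltW xp) ?poweR_ge0.
pose D := (d / r) `^ q^-1.
have Dq : D `^ q = d / r.
  by rewrite /D -powRrM mulVf ?gt_eqF// powRr1// divr_ge0// ltW.
have yD : (y <= D%:E)%E.
  apply: (cvge_to_le vy); near=> j.
  have : (v j `^ q <= (d / r)%:E)%E.
    rewrite -(lee_pmul2l (_ : r%:E \is a fin_num)) ?lte_fin//.
    by rewrite -EFinM mulrC divfK ?gt_eqF.
  have := v0 j; case: (v j) => [w| |] //=; last first.
    by rewrite gt_eqF.
  rewrite !lee_fin => w0 wq.
  rewrite -[leLHS](powRr1 w0) -(mulfV (lt0r_neq0 q0)) powRrM.
  by apply: ge0_ler_powR; rewrite ?nnegrE ?powR_ge0 ?invr_ge0 ?(ltW q0)// divr_ge0// ltW.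
apply: (@le_trans _ _ (r%:E * D%:E `^ q)%E).
  apply: lee_pmul; rewrite ?lee_fin ?(ltW xp) ?poweR_ge0//.
  by apply: gt0_ler_poweR; rewrite ?in_itv/= ?leey ?andbT ?y0 ?(ltW q0)// lee_fin powR_ge0.
by rewrite poweR_EFin Dq -EFinM mulrC divfK// gt_eqF.
Unshelve. all: by end_near. Qed.

Section prekopa_leindler.
Context {R : realType}.
Local Notation mu := (@lebesgue_measure R).
Implicit Types (A B C : set R) (l : R).

Lemma lebesgue_measure_affine A (a b : R) : 0 < a -> measurable A ->
  (mu [set x | A (a^-1 * (x - b))%R] = a%:E * mu A)%E.
Proof.
move=> a0 mA.
pose phi := fun x : measurableTypeR R => (a^-1 * (x - b) : measurableTypeR R).
have mphi : measurable_fun [set: measurableTypeR R] phi.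
  by apply: measurable_funM => //; exact: measurable_funB.
have a1 : 0 <= a^-1 by rewrite invr_ge0 ltW.
have mE : mu A = mscale (NngNum a1) (pushforward mu phi) A.
  move=> mm; apply: lebesgue_measure_unique => // _ [[c d]] /= _ <-.
  rewrite /mscale/= /pushforward.
  have -> : phi @^-1` `]c, d] = `]a * c + b, a * d + b]%classic.
    have phiE x : phi x = (x - b) / a by rewrite /phi mulrC.
    apply/seteqP; split => x /=; rewrite !in_itv/= phiE ltr_pdivlMr// ler_pdivrMr//;
      rewrite ![_ * a]mulrC => /andP[h1 h2]; lra.
  rewrite !lebesgue_measure_itv/= !lte_fin ltrD2r ltr_pM2l//.
  case: ifP => _; rewrite ?mule0// -!EFinB -EFinM; congr (_%:E).
  by rewrite opprD addrACA subrr addr0 -mulrBr mulrA mulVf ?mul1r ?gt_eqF.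
rewrite (mE mphi).
by rewrite /mscale/= /pushforward muleA -EFinM mulfV ?mul1e ?gt_eqF.
Qed.

(** With [a] near [sup A] and [b] near [inf B], the sets [l A + (1 - l) b] and [l a + (1 - l) B] lie
    in [C] and, up to a small loss, on opposite sides of the point [l a + (1 - l) b], so their
    measures add up. *)
Lemma brunn_minkowski1 A B C l M : 0 < l < 1 ->
  measurable A -> measurable B -> measurable C -> A !=set0 -> B !=set0 ->
  (forall a, A a -> a <= M) -> (forall b, B b -> - M <= b) ->
  (forall a b, A a -> B b -> C (l * a + (1 - l) * b)) ->
  (l%:E * mu A + (1 - l)%:E * mu B <= mu C)%E.
Proof.
move=> /andP[l0 l1] mA mB mC A0 B0 AM BM ABC.
have l1' : 0 < 1 - l by rewrite subr_gt0.
apply/lee_addgt0Pr => e e0.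
have supA : has_sup A by split => //; exists M.
have infB : has_inf B by split => //; exists (- M).
have [a Aa ae] := sup_adherent e0 supA.
have [b Bb be] := inf_adherent e0 infB.
pose A1 := A `&` `]-oo, a]; pose B1 := B `&` `]b, +oo[.
have mA1 : measurable A1 by exact: measurableI.
have mB1 : measurable B1 by exact: measurableI.
have leA : (mu A <= mu A1 + e%:E)%E.
  apply: (@le_trans _ _ (mu (A1 `|` `]a, sup A]))).
    apply: le_measure; rewrite ?inE//; first exact: measurableU.
    move=> x Ax; have [xa|ax] := leP x a; [left|right]; first by split => //=; rewrite in_itv.
    by rewrite /= in_itv/= ax; exact: sup_upper_bound.
  apply: le_trans (measureU2 _ _ _) _ => //; rewrite leeD2l//.
  suff : (mu `]a, sup A] <= e%:E)%E by [].
  rewrite lebesgue_measure_itv/=; case: ifP => _; [rewrite -EFinB lee_fin|rewrite lee_fin ltW]; lra.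
have leB : (mu B <= mu B1 + e%:E)%E.
  apply: (@le_trans _ _ (mu (B1 `|` `[inf B, b]))).
    apply: le_measure; rewrite ?inE//; first exact: measurableU.
    move=> x Bx; have [xb|bx] := leP x b; [right|left]; last by split => //=; rewrite in_itv/= bx.
    by rewrite /= in_itv/= xb andbT; exact: ge_inf infB.2 _ Bx.
  apply: le_trans (measureU2 _ _ _) _ => //; rewrite leeD2l//.
  suff : (mu `[inf B, b] <= e%:E)%E by [].
  rewrite lebesgue_measure_itv/=; case: ifP => _; [rewrite -EFinB lee_fin|rewrite lee_fin ltW]; lra.
(* [A2] is [l A1 + (1 - l) b] and [B2] is [l a + (1 - l) B1]. Since [A1] is cut at a closed end and
   [B1] at an open one, they are disjoint. The losses [l e] and [(1 - l) e] sum to [e]. *)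
pose A2 := [set x | A1 (l^-1 * (x - (1 - l) * b))].
pose B2 := [set x | B1 ((1 - l)^-1 * (x - l * a))].
have mA2 : measurable A2.
  rewrite -[X in measurable X]setTI; apply: (measurable_funM _ _ measurableT) => //.
  exact: measurable_funB.
have mB2 : measurable B2.
  rewrite -[X in measurable X]setTI; apply: (measurable_funM _ _ measurableT) => //.
  exact: measurable_funB.
have AC : A2 `|` B2 `<=` C.
  move=> x [[Ax _]|[Bx _]].
    have := ABC _ _ Ax Bb; rewrite mulrA mulfV ?gt_eqF// mul1r subrK//.
  have := ABC _ _ Aa Bx; rewrite mulrA mulfV ?gt_eqF// mul1r addrC subrK//.
have AB0 : A2 `&` B2 = set0.
  apply/seteqP; split => // x [[_ /=]] + [_ /=].
  rewrite !in_itv/= andbT ![_^-1 * _]mulrC ler_pdivrMr// ltr_pdivlMr//; lra.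
have : (mu A2 + mu B2 <= mu C)%E.
  rewrite -measureU//; apply: le_measure; rewrite ?inE//; exact: measurableU.
rewrite /A2 /B2 !lebesgue_measure_affine// => ABle.
apply: (@le_trans _ _ (l%:E * (mu A1 + e%:E) + (1 - l)%:E * (mu B1 + e%:E))%E).
  by apply: leeD; rewrite lee_pmul2l// lte_fin.
have e0' := ltW e0.
rewrite !ge0_muleDr ?lee_fin// addeACA leeD// -!EFinM -EFinD lee_fin; lra.
Qed.

Lemma integral_level_sets (f : R -> R) : measurable_fun setT f ->
  (forall x, 0 <= f x) ->
  (\int[mu]_x (f x)%:E = \int[mu]_(u in `[0%R, +oo[) mu [set x | (u < f x)%R])%E.
Proof.
move=> mf f0.
pose F (xu : R * R) := (\1_[set xu : R * R | (0 <= xu.2) && (xu.2 < f xu.1)] xu)%:E : \bar R.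
have mset : measurable [set xu : R * R | (0 <= xu.2) && (xu.2 < f xu.1)].
  rewrite [X in measurable X](_ : _ = [set xu | 0 <= xu.2] `&` [set xu | xu.2 < f xu.1]).
    apply: measurableI; rewrite -[X in measurable X]setTI.
      by apply: measurable_fun_le => //; exact: measurable_cst.
    by rewrite setTI; apply: measurable_lt_set => //; exact: measurableT_comp.
  by apply/seteqP; split => xu /= /andP.
have mF : measurable_fun setT F by apply/measurable_EFinP.
transitivity (\int[mu]_x \int[mu]_u F (x, u))%E.
  apply: eq_integral => x _.
  rewrite (_ : (fun u => F (x, u)) = (fun u => (\1_`[0, f x[ u)%:E)).
    transitivity (mu `[0, f x[); last by rewrite integral_indic// setIT.
    rewrite lebesgue_measure_itv/= lte_fin.
    by case: ltP => [_|fx]; rewrite ?sube0//; congr (_%:E); apply/eqP; rewrite eq_le f0 fx.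
  by apply/funext => u; congr (_%:E); apply: indic_eq; rewrite /= in_itv.
rewrite (fubini_tonelli (m1 := mu) (m2 := mu) F)//; last by move=> xu; rewrite lee_fin.
rewrite [RHS]integral_mkcond; apply: eq_integral => u _.
rewrite patchE; case: ifPn => [/set_mem|/negP].
  rewrite /= in_itv/= andbT => u0.
  rewrite (_ : (fun x => F (x, u)) = (fun x => (\1_[set x | u < f x] x)%:E)).
    rewrite integral_indic ?setIT// -[X in measurable X]setTI.
    by rewrite setTI; apply: measurable_lt_set.
  by apply/funext => x; congr (_%:E); apply: indic_eq; rewrite /= u0.
rewrite inE/= in_itv/= andbT => u0; apply: integral0_eq => x _.
rewrite /F indicE memNset//= => /andP[h _]; exact: u0.
Qed.

Lemma measurable_level_sets (f : R -> R) : measurable_fun setT f ->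
  measurable_fun setT (fun u : R => mu [set x | u < f x]).
Proof.
move=> mf; have mset : measurable [set xu : R * R | xu.2 < f xu.1].
  by apply: measurable_lt_set => //; exact: measurableT_comp.
have := measurable_fun_ysection mu mset; congr (measurable_fun _ _).
by apply/funext => u /=; congr (mu _); apply/seteqP; split => x; rewrite /ysection/= inE.
Qed.

(** Because both suprema are 1, the level sets of [f] and [g] at every [u < 1] are nonempty, so
    Brunn-Minkowski applies level by level. This yields the arithmetic mean of the integrals, which
    is stronger than the geometric one. *)
Lemma prekopa_leindler_normalized (f g h : R -> R) l M : 0 < l < 1 ->
  measurable_fun setT f -> measurable_fun setT g -> measurable_fun setT h ->
  (forall x, 0 <= f x <= 1) -> (forall x, 0 <= g x <= 1) -> (forall x, 0 <= h x) ->
  (forall u, u < 1 -> exists x, u < f x) -> (forall u, u < 1 -> exists x, u < g x) ->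
  (forall x, M < x -> f x = 0) -> (forall x, x < - M -> g x = 0) ->
  (forall s t, f s `^ l * g t `^ (1 - l) <= h (l * s + (1 - l) * t)) ->
  (l%:E * \int[mu]_x (f x)%:E + (1 - l)%:E * \int[mu]_x (g x)%:E <=
   \int[mu]_x (h x)%:E)%E.
Proof.
move=> l01 mf mg mh f01 g01 h0 supf supg suppf suppg fgh.
have [l0 l1] := andP l01; have l1' : 0 < 1 - l by rewrite subr_gt0.
have f0 x : 0 <= f x by case/andP: (f01 x).
have g0 x : 0 <= g x by case/andP: (g01 x).
have mD : measurable (`[0%R, +oo[%classic : set R) by exact: measurable_itv.
have mlev k : measurable_fun setT k -> measurable_fun (`[0%R, +oo[ : set R)
    (fun u : R => mu [set x | u < k x]).
  by move=> mk; apply: measurable_funTS; exact: measurable_level_sets.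
have mlevl k c : measurable_fun setT k -> measurable_fun (`[0%R, +oo[ : set R)
    (fun u : R => c%:E * mu [set x | (u < k x)%R])%E.
  by move=> mk; apply: emeasurable_funM => //; exact: mlev.
rewrite !integral_level_sets// -!ge0_integralZl_EFin ?(ltW l0) ?(ltW l1')//;
  [|exact: mlev|exact: mlev].
rewrite -ge0_integralD//; first last.
- exact: mlevl.
- by move=> u _; rewrite mule_ge0// lee_fin ltW.
- exact: mlevl.
- by move=> u _; rewrite mule_ge0// lee_fin ltW.
apply: ge0_le_integral => //.
- by move=> u _; rewrite adde_ge0// mule_ge0// lee_fin ltW.
- by apply: emeasurable_funD; exact: mlevl.
- exact: mlev.
move=> u; rewrite /= in_itv/= andbT => u0.
have [u1|u1] := ltP u 1; last first.
  have lev0 (k : R -> R) : (forall x, 0 <= k x <= 1) -> [set x | u < k x] = set0.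
    move=> k01; apply/seteqP; split => // x /=.
    by rewrite ltNge (le_trans _ u1)//; case/andP: (k01 x).
  by rewrite (lev0 _ f01) (lev0 _ g01) measure0 !mule0 adde0.
apply: (@brunn_minkowski1 _ _ _ _ M) => //.
- by apply: measurable_lt_set.
- by apply: measurable_lt_set.
- by apply: measurable_lt_set.
- exact: supf.
- exact: supg.
- move=> a /= ufa; rewrite leNgt; apply/negP => /suppf fa.
  by move: ufa; rewrite fa ltNge u0.
- move=> b /= ugb; rewrite leNgt; apply/negP => /suppg gb.
  by move: ugb; rewrite gb ltNge u0.
move=> a b /= ufa ugb; apply: lt_le_trans (fgh _ _).
(* Splitting the level this way turns [u < f a] and [u < g b] into a lower bound on [h]. *)
have uE : u = u `^ l * u `^ (1 - l).
  rewrite -powRD; first by rewrite addrC subrK powRr1.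
  by rewrite addrC subrK oner_eq0.
rewrite [ltLHS]uE; apply: ltr_pM; rewrite ?powR_ge0//.
  by apply: gt0_ltr_powR; rewrite ?nnegrE.
by apply: gt0_ltr_powR; rewrite ?nnegrE.
Qed.

Lemma weighted_AMGM l (x y : R) : 0 < l < 1 -> 0 <= x -> 0 <= y ->
  x `^ l * y `^ (1 - l) <= l * x + (1 - l) * y.
Proof.
move=> /andP[l0 l1] x0 y0; have l1' : 0 < 1 - l by rewrite subr_gt0.
have := @conjugate_powR R (x `^ l) (y `^ (1 - l)) l^-1 (1 - l)^-1.
rewrite !powR_ge0 !invr_gt0 l0 l1' !invrK => /(_ isT isT isT isT).
rewrite addrC subrK => /(_ erefl).
by rewrite -!powRrM !mulfV ?gt_eqF// !powRr1// ![_ * l]mulrC ![_ * (1 - l)]mulrC.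
Qed.

(** Reduction to suprema equal to 1: divide [f] and [g] by their suprema, [h] by the matching
    constant, and return from sums to products by the weighted AM-GM inequality with weights [1/p]
    and [1 - 1/p]. *)
Lemma prekopa_leindler_bounded (f g h : R -> R) p M : 1 < p ->
  measurable_fun setT f -> measurable_fun setT g -> measurable_fun setT h ->
  (forall x, 0 <= f x <= M) -> (forall x, 0 <= g x <= M) -> (forall x, 0 <= h x) ->
  (forall x, M < `|x| -> f x = 0) -> (forall x, M < `|x| -> g x = 0) ->
  (forall s t, f s * g t `^ (p - 1) <= h (p^-1 * (s + (p - 1) * t)) `^ p) ->
  (\int[mu]_x (f x)%:E * (\int[mu]_x (g x)%:E) `^ (p - 1) <=
   (\int[mu]_x (h x)%:E) `^ p)%E.
Proof.
move=> p1 mf mg mh f0M g0M h0 suppf suppg fgh.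
have p0 : 0 < p by exact: lt_trans p1.
have p10 : 0 < p - 1 by rewrite subr_gt0.
have int0 (k : R -> R) : (forall x, 0 <= k x <= M) -> ~ (exists x, 0 < k x) ->
    (\int[mu]_x (k x)%:E = 0)%E.
  move=> k0 kn; apply: integral0_eq => x _; congr (_%:E); apply/eqP.
  rewrite eq_le; case/andP: (k0 x) => -> _; rewrite andbT leNgt.
  by apply/negP => kx; apply: kn; exists x.
have [f_gt0|/(int0 _ f0M) ->] := pselect (exists x, 0 < f x); last first.
  by rewrite mul0e poweR_ge0.
have [g_gt0|/(int0 _ g0M) ->] := pselect (exists x, 0 < g x); last first.
  by rewrite poweR0r ?mule0 ?poweR_ge0// gt_eqF.
have sup_gt0 (k : R -> R) : (forall x, 0 <= k x <= M) -> (exists x, 0 < k x) ->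
    exists m, [/\ 0 < m, forall x, 0 <= k x / m <= 1 &
      forall u, u < 1 -> exists x, u < k x / m].
  move=> k0 [x kx].
  have hs : has_sup (range k).
    by split; [exists (k x), x|exists M => _ [y _ <-]; case/andP: (k0 y)].
  have m0 : 0 < sup (range k) by apply: lt_le_trans kx _; apply: sup_upper_bound => //; exists x.
  exists (sup (range k)); split => //.
    move=> y; have /andP[ky _] := k0 y; rewrite divr_ge0 ?(ltW m0)//=.
    by rewrite ler_pdivrMr// mul1r; apply: sup_upper_bound => //; exists y.
  move=> u u1; have e0 : 0 < (1 - u) * sup (range k) by rewrite mulr_gt0// subr_gt0.
  have [_ [y _ <-]] := sup_adherent e0 hs; rewrite mulrBl mul1r opprB addrC subrK => ky.
  by exists y; rewrite ltr_pdivlMr.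
have [a [a0 fa1 fa]] := sup_gt0 _ f0M f_gt0.
have [b [b0 gb1 gb]] := sup_gt0 _ g0M g_gt0.
(* The only scaling of [h] compatible with the hypothesis, since [k^p = a b^(p-1)]. *)
pose k := a `^ p^-1 * b `^ (1 - p^-1).
have k0 : 0 < k by rewrite mulr_gt0// powR_gt0.
have pV01 : 0 < p^-1 < 1 by rewrite invr_gt0 p0 invf_lt1.
have pM1 : (1 - p^-1) * p = p - 1 by rewrite mulrBl mul1r mulVf// gt_eqF.
have kp : k `^ p = a * b `^ (p - 1).
  by rewrite powRM ?powR_ge0// -!powRrM mulVf ?gt_eqF// powRr1 ?(ltW a0)// pM1.
have int_div (j : R -> R) c : 0 < c -> measurable_fun setT j -> (forall x, 0 <= j x) ->
    (\int[mu]_x (j x / c)%:E = c^-1%:E * \int[mu]_x (j x)%:E)%E.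
  move=> c0 mj j0; rewrite -ge0_integralZl_EFin ?invr_ge0 ?(ltW c0)//.
  - by apply: eq_integral => x _; rewrite mulrC.
  - by move=> x _; rewrite lee_fin.
  - exact/measurable_EFinP.
have f0 x : 0 <= f x by case/andP: (f0M x).
have g0 x : 0 <= g x by case/andP: (g0M x).
have mdiv (j : R -> R) c : measurable_fun setT j -> measurable_fun setT (fun x => j x / c).
  by move=> mj; apply: measurable_funM.
have mfa := mdiv _ a mf; have mgb := mdiv _ b mg; have mhk := mdiv _ k mh.
have : (p^-1%:E * \int[mu]_x (f x / a)%:E + (1 - p^-1)%:E * \int[mu]_x (g x / b)%:E
    <= \int[mu]_x (h x / k)%:E)%E.
  apply: (@prekopa_leindler_normalized _ _ _ _ M) => //.
  - by move=> x; rewrite divr_ge0 ?(ltW k0).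
  - by move=> x Mx; rewrite suppf ?mul0r// (lt_le_trans Mx)// ler_norm.
  - by move=> x; rewrite ltrNr => Mx; rewrite suppg ?mul0r// (lt_le_trans Mx)// -normrN ler_norm.
  - move=> s t; rewrite ler_pdivlMr//.
    have zE : p^-1 * s + (1 - p^-1) * t = p^-1 * (s + (p - 1) * t).
      by field; rewrite gt_eqF.
    have : (f s * g t `^ (p - 1)) `^ p^-1 <= (h (p^-1 * (s + (p - 1) * t)) `^ p) `^ p^-1.
      by apply: ge0_ler_powR; rewrite ?nnegrE ?powR_ge0 ?mulr_ge0 ?powR_ge0 ?invr_ge0 ?(ltW p0).
    rewrite zE powRM ?powR_ge0// -!powRrM mulfV ?gt_eqF// powRr1//.
    rewrite (_ : (p - 1) / p = 1 - p^-1); last by rewrite mulrBl mul1r mulfV ?gt_eqF.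
    apply: le_trans; rewrite -{2}[f s](divfK (lt0r_neq0 a0)) -{2}[g t](divfK (lt0r_neq0 b0)).
    rewrite [(f s / a * a) `^ _]powRM ?divr_ge0 ?(ltW a0)//.
    rewrite [(g t / b * b) `^ _]powRM ?divr_ge0 ?(ltW b0)//.
    by rewrite mulrACA.
rewrite !int_div//.
have fin (j : R -> R) : measurable_fun setT j -> (forall x, 0 <= j x <= M) ->
    (forall x, M < `|x| -> j x = 0) -> exists2 I, 0 <= I & (\int[mu]_x (j x)%:E = I%:E)%E.
  move=> mj j0 js.
  have j0' x : (0 <= (j x)%:E)%E by rewrite lee_fin; case/andP: (j0 x).
  have lty : (\int[mu]_x (j x)%:E < +oo)%E.
    apply: (@le_lt_trans _ _ (\int[mu]_(x in `[(- M)%R, M]) M%:E)%E).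
      rewrite [leRHS]integral_mkcond; apply: ge0_le_integral => //.
      - exact/measurable_EFinP.
      - by apply/(measurable_restrictT _ _).1.
      move=> x _; rewrite patchE; case: ifPn => [_|]; first by rewrite lee_fin; case/andP: (j0 x).
      rewrite notin_setE/= in_itv/= => /negP; rewrite -ler_norml -ltNge => /js ->//.
    rewrite [ltLHS](_ : _ = (M%:E * mu `[(- M)%R, M])%E); last by rewrite integral_cst.
    rewrite lebesgue_measure_itv/=; case: ifP => _; rewrite ?mule0//.
    by rewrite -EFinB -EFinM ltry.
  have ge0 : (0 <= \int[mu]_x (j x)%:E)%E by apply: integral_ge0 => x _; exact: j0'.
  exists (fine (\int[mu]_x (j x)%:E)%E); first by rewrite fine_ge0.
  by rewrite fineK// ge0_fin_numE.
have [I I0 ->] := fin _ mf f0M suppf.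
have [J J0 ->] := fin _ mg g0M suppg.
have h0' x : (0 <= (h x)%:E)%E by rewrite lee_fin.
have : (0 <= \int[mu]_x (h x)%:E)%E by apply: integral_ge0 => x _; exact: h0'.
case: (\int[mu]_x (h x)%:E)%E => [H| |]// H0; last first.
  by rewrite [(+oo `^ p)%E]poweRyr ?gt_eqF// leey.
rewrite -!EFinM -EFinD lee_fin => le_H.
rewrite poweR_EFin lee_fin.
have X0 : 0 <= a^-1 * I by rewrite mulr_ge0// invr_ge0 ltW.
have Y0 : 0 <= b^-1 * J by rewrite mulr_ge0// invr_ge0 ltW.
have := le_trans (weighted_AMGM pV01 X0 Y0) le_H.
rewrite -(ler_pM2l k0) mulrA mulfV ?gt_eqF// mul1r => le_kH.
have : (k * ((a^-1 * I) `^ p^-1 * (b^-1 * J) `^ (1 - p^-1))) `^ p <= H `^ p.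
  by apply: ge0_ler_powR; rewrite ?nnegrE ?(ltW p0)// mulr_ge0 ?(ltW k0)// mulr_ge0 ?powR_ge0.
apply: le_trans; rewrite powRM ?(ltW k0) ?mulr_ge0 ?powR_ge0// kp.
rewrite powRM ?powR_ge0// -!powRrM mulVf ?gt_eqF// powRr1// pM1.
rewrite mulrACA [a * _]mulrA mulfV ?gt_eqF// mul1r -powRM ?(ltW b0)//.
by rewrite [b * _]mulrA mulfV ?gt_eqF// mul1r.
Qed.

Let trunc (f : R -> \bar R) (N : nat) (x : R) : R :=
  fine (mine (f x) N%:R%:E) * \1_(`[- N%:R, N%:R] : set R) x.

Let fine_min (f : R -> \bar R) (N : nat) x : (0 <= f x)%E ->
  mine (f x) N%:R%:E = (fine (mine (f x) N%:R%:E))%:E.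
Proof.
move=> f0; rewrite fineK// ge0_fin_numE.
  by rewrite gt_min ltry orbT.
by rewrite le_min f0 lee_fin ler0n.
Qed.

Let trunc_le (f : R -> \bar R) (N : nat) x : (0 <= f x)%E ->
  ((trunc f N x)%:E <= f x)%E.
Proof.
move=> f0; rewrite /trunc EFinM -fine_min// indicE.
case: (_ \in _); first by rewrite mule1 ge_min lexx.
by rewrite mule0.
Qed.

Let trunc_bound (f : R -> \bar R) (N : nat) x : (0 <= f x)%E ->
  0 <= trunc f N x <= N%:R.
Proof.
move=> f0; rewrite /trunc; have h : (mine (f x) N%:R%:E <= N%:R%:E)%E.
  by rewrite ge_min lexx orbT.
have h0 : (0 <= mine (f x) N%:R%:E)%E by rewrite le_min f0 lee_fin ler0n.
rewrite indicE; case: (_ \in _); rewrite ?mulr1 ?mulr0 ?lexx ?ler0n//.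
by rewrite -lee_fin -[X in _ && X]lee_fin -fine_min// h0.
Qed.

Let trunc_supp (f : R -> \bar R) (N : nat) x : N%:R < `|x| -> trunc f N x = 0.
Proof.
move=> Nx; rewrite /trunc indicE memNset ?mulr0//= in_itv/= -ler_norml.
by apply/negP; rewrite -ltNge.
Qed.

Let measurable_trunc (f : R -> \bar R) N : measurable_fun setT f ->
  measurable_fun setT (trunc f N).
Proof.
move=> mf; apply: measurable_funM => //.
apply: measurableT_comp => //.
by apply: measurable_mine.
Qed.

Let cvg_integral_trunc (f : R -> \bar R) : measurable_fun setT f ->
  (forall x, (0 <= f x)%E) ->
  (\int[mu]_x (trunc f N x)%:E @[N --> \oo] --> \int[mu]_x f x)%E.
Proof.
move=> mf f0.
have pw x : (trunc f N x)%:E @[N --> \oo] --> f x.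
  have [f_lt|] := ltP (f x) +oo%E; last rewrite leye_eq => /eqP fx.
    apply: cvg_near_cst; near=> N; rewrite /trunc EFinM -fine_min//.
    have xN : `|x| <= N%:R by near: N; exact: nbhs_infty_ger.
    rewrite indicE mem_set/=; last by rewrite in_itv/= -ler_norml.
    rewrite mule1; apply/min_idPl.
    rewrite -(@fineK _ (f x)) ?ge0_fin_numE// lee_fin.
    by near: N; exact: nbhs_infty_ger.
  rewrite fx; apply/cvgeyPge => A; near=> N; rewrite /trunc fx.
  have xN : `|x| <= N%:R by near: N; exact: nbhs_infty_ger.
  rewrite indicE mem_set/=; last by rewrite in_itv/= -ler_norml.
  rewrite mulr1 lee_fin.
  by near: N; exact: nbhs_infty_ger.
have -> : (\int[mu]_x f x = \int[mu]_x limn (fun N => (trunc f N x)%:E))%E.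
  by apply: eq_integral => x _; apply/esym/cvg_lim.
apply: cvg_monotone_convergence => //.
- by move=> N; apply/measurable_EFinP; exact: measurable_trunc.
- by move=> N x _; rewrite lee_fin; case/andP: (trunc_bound N (f0 x)).
- move=> x _ N N' NN'; rewrite /trunc !EFinM -!fine_min//.
  have NN'R : (N%:R <= N'%:R :> R) by rewrite ler_nat.
  apply: lee_pmul => //.
  + by rewrite le_min f0 lee_fin ler0n.
  + by rewrite le_min ge_min lexx/= ge_min lee_fin NN'R orbT.
  + rewrite lee_fin !indicE; have [xN|xN] := boolP (x \in _); last by rewrite ler0n.
    rewrite mem_set//=; move/set_mem: xN; rewrite /= !in_itv/= -!ler_norml => h.
    exact: le_trans h NN'R.
Unshelve. all: by end_near. Qed.

(** Truncating [f] and [g] in height and support only decreases them, so the hypothesis on [h]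
    survives. The truncation levels [i] and [j] are independent, as [le_mul_poweR_lim] requires. *)
Theorem prekopa_leindler (f g : R -> \bar R) (h : R -> R) p : 1 < p ->
  measurable_fun setT f -> measurable_fun setT g -> measurable_fun setT h ->
  (forall x, (0 <= f x)%E) -> (forall x, (0 <= g x)%E) -> (forall x, 0 <= h x) ->
  (forall s t, (f s * g t `^ (p - 1) <= (h (p^-1 * (s + (p - 1) * t)) `^ p)%:E)%E) ->
  (\int[mu]_x f x * (\int[mu]_x g x) `^ (p - 1) <=
   (\int[mu]_x (h x)%:E) `^ p)%E.
Proof.
move=> p1 mf mg mh f0 g0 h0 fgh.
have tr0 k N x : (0 <= k x)%E -> (0 <= (trunc k N x)%:E)%E.
  by move=> k0; rewrite lee_fin; case/andP: (trunc_bound N k0).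
apply: (@le_mul_poweR_lim _ _ (fun N => \int[mu]_x (trunc f N x)%:E)%E
  (fun N => \int[mu]_x (trunc g N x)%:E)%E) => //.
- by rewrite subr_gt0.
- by move=> N; apply: integral_ge0 => x _; exact: tr0.
- by move=> N; apply: integral_ge0 => x _; exact: tr0.
- exact: cvg_integral_trunc.
- exact: cvg_integral_trunc.
move=> i j; apply: (@prekopa_leindler_bounded _ _ _ _ (maxn i j)%:R) => //.
- exact: measurable_trunc.
- exact: measurable_trunc.
- move=> x; have /andP[-> h1] := trunc_bound i (f0 x).
  by rewrite (le_trans h1)// ler_nat leq_maxl.
- move=> x; have /andP[-> h1] := trunc_bound j (g0 x).
  by rewrite (le_trans h1)// ler_nat leq_maxr.
- move=> x mx; apply: trunc_supp; apply: le_lt_trans mx.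
  by rewrite ler_nat leq_maxl.
- move=> x mx; apply: trunc_supp; apply: le_lt_trans mx.
  by rewrite ler_nat leq_maxr.
move=> s t; rewrite -lee_fin; apply: le_trans (fgh s t).
rewrite EFinM -poweR_EFin; apply: lee_pmul => //.
- exact: tr0.
- exact: poweR_ge0.
- exact: trunc_le.
- apply: gt0_ler_poweR; rewrite ?in_itv/= ?leey ?andbT//.
  + by rewrite subr_ge0 ltW.
  + exact: tr0.
  + exact: trunc_le.
Qed.

End prekopa_leindler.

(** * The two implications *)

Section main.
Context {R : realType} {n : nat}.
Local Notation rV := 'rV[R]_n.+1.
Local Notation mu := (@lebesgue_measure R).
Local Notation vol := (@lebesgue_rV R n).
Variables (p : R) (V : rV -> R).
Hypotheses (p1 : 1 < p) (evenV : even_fun V) (convV : strictly_convex V)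
  (homV : homogeneous p V) (C2V : C2 V).
Implicit Types (x y z : rV) (K A M : set rV) (s t r l : R).

Let p0 : 0 < p. Proof. exact: lt_trans p1. Qed.
Let p10 : 0 < p - 1. Proof. by rewrite subr_gt0. Qed.

(** * Volumes of sublevel sets and the layer-cake constant *)

Let L : set rV := [set x | V x <= p^-1].

Let powRVK s : 0 <= s -> (s `^ p^-1) `^ p = s.
Proof. by move=> s0; rewrite -powRrM mulVf ?powRr1// gt_eqF. Qed.

(* The volume of (p s)^(1/p) K is weight s * |K| for s > 0. *)
Let weight s : R := Num.max 0 (p * s) `^ (n.+1%:R / p).

Let weight_ge0 s : 0 <= weight s. Proof. exact: powR_ge0. Qed.

Let dim_gt0 : 0 < n.+1%:R / p :> R.
Proof. by rewrite divr_gt0. Qed.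

Let weight_le0 s : s <= 0 -> weight s = 0.
Proof.
move=> s0; rewrite /weight max_l ?powR0 ?gt_eqF//.
by rewrite pmulr_rle0.
Qed.

Let weight_gt0E s : 0 < s -> weight s = (p * s) `^ (n.+1%:R / p).
Proof. by move=> s0; rewrite /weight max_r// ltW// mulr_gt0. Qed.

Let dilation s : R := (p * s) `^ p^-1.

Let dilation_gt0 s : 0 < s -> 0 < dilation s.
Proof. by move=> s0; rewrite powR_gt0// mulr_gt0. Qed.

Let dilationK s : 0 < s -> dilation s `^ p = p * s.
Proof. by move=> s0; rewrite powRVK// mulr_ge0// ltW. Qed.

Let vol_dilation s A : 0 < s ->
  vol [set x | A ((dilation s)^-1 *: x)] = ((weight s)%:E * vol A)%E.
Proof.
move=> s0; rewrite lebesgue_rVZ ?dilation_gt0//; congr (_%:E * _)%E.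
rewrite weight_gt0E// -powR_mulrn; last by rewrite ltW// dilation_gt0.
by rewrite /dilation -powRrM; congr (_ `^ _); rewrite mulrC.
Qed.

Let sublevel_dilation s : 0 < s ->
  [set x | V x <= s] = [set x | L ((dilation s)^-1 *: x)].
Proof.
move=> s0; have d0 := dilation_gt0 s0.
apply/seteqP; split => x; rewrite /L/= homV ?invr_ge0 ?(ltW d0)//;
  rewrite -[(dilation s)^-1]powR_inv1 ?(ltW d0)// -powRrM mulN1r powRN dilationK//;
  by rewrite ler_pdivrMl ?mulr_gt0// [p * s]mulrC mulfK ?gt_eqF.
Qed.

Let vol_sublevel s : vol [set x | V x <= s] = ((weight s)%:E * vol L)%E.
Proof.
have [s0|s0] := ltP 0 s; first by rewrite sublevel_dilation// vol_dilation.
rewrite weight_le0// mul0e; apply/eqP; rewrite eq_le lebesgue_outer_ge0 andbT.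
rewrite -(@lebesgue_rV_set1 R n); apply: le_lebesgue_outer => x /= xs.
apply/eqP; apply: contraT => /(homogeneous_gt0 p1 evenV convV homV).
by rewrite ltNge (le_trans xs).
Qed.

Let vol_L_lty : (vol L < +oo)%E.
Proof.
have [r Lr] := sublevel_bounded p1 evenV convV homV C2V p^-1.
exact: lebesgue_rV_bounded Lr.
Qed.

Let vL : R := fine (vol L).

Let vol_LE : vol L = vL%:E.
Proof. by rewrite fineK// ge0_fin_numE// lebesgue_outer_ge0. Qed.

Let vL_ge0 : 0 <= vL.
Proof. by rewrite fine_ge0// lebesgue_outer_ge0. Qed.

Let measurable_weight : measurable_fun [set: R] weight.
Proof.
apply: (measurableT_comp (measurable_powR _)).
by apply: measurable_maxr => //; exact: measurable_funM.
Qed.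

Let kernel s : R := expR (- s) * weight s.

Let kernel_ge0 s : 0 <= kernel s.
Proof. by rewrite mulr_ge0 ?expR_ge0. Qed.

Let measurable_kernel : measurable_fun [set: R] kernel.
Proof.
apply: measurable_funM => //.
by apply: measurableT_comp => //; exact: measurableT_comp.
Qed.

(** With [k = n.+1 / p] this is [p^k Gamma(k + 1)]; only [0 < C < +oo] matters. *)
Let C := (\int[mu]_s (kernel s)%:E)%E.

Let C_gt0 : (0 < C)%E.
Proof.
apply: (@lt_le_trans _ _ (\int[mu]_(s in `[1%R, 2%R]) (expR (- 2) * p `^ (n.+1%:R / p))%:E)%E).
  rewrite integral_cst//= lebesgue_measure_itv/= lte_fin ltr1n -EFinB -EFinM lte_fin.
  by rewrite mulr_gt0// ?mulr_gt0 ?expR_gt0 ?powR_gt0//; lra.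
apply: (@le_trans _ _ (\int[mu]_(s in `[1%R, 2%R]) (kernel s)%:E)%E).
  apply: ge0_le_integral => //.
  - by move=> s _; rewrite lee_fin mulr_ge0 ?expR_ge0 ?powR_ge0.
  - by apply/measurable_EFinP; exact: measurable_funTS.
  move=> s; rewrite /= in_itv/= => /andP[s1 s2]; rewrite lee_fin.
  have s0 : 0 < s by exact: lt_le_trans s1.
  rewrite /kernel weight_gt0E//; apply: ler_pM; rewrite ?expR_ge0 ?powR_ge0//.
    by rewrite ler_expR lerN2.
  apply: ge0_ler_powR; rewrite ?nnegrE ?(ltW dim_gt0) ?(ltW p0) ?mulr_ge0 ?(ltW p0) ?(ltW s0)//.
  by rewrite ler_pMr.
apply: ge0_subset_integral => //; last by move=> s _; rewrite lee_fin.
by apply/measurable_EFinP.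
Qed.

Let C_lty : (C < +oo)%E.
Proof.
(* Chosen so that [s / a <= exp (s / a)], raised to the power [n.+1 / p], costs exactly
   [exp (s / 2)]. The factor 2 in [B] compensates the rate [1/2] of the exponential density. *)
pose a := 2 * (n.+1%:R / p); have a0 : 0 < a by rewrite mulr_gt0.
pose B := 2 * (p * a) `^ (n.+1%:R / p).
have B0 : 0 <= B by rewrite mulr_ge0// powR_ge0.
have h0 : 0 < (2^-1 : R) by rewrite invr_gt0.
have mpdf : measurable_fun setT (exponential_pdf (2^-1 : R)).
  exact: measurable_exponential_pdf.
apply: (@le_lt_trans _ _ (\int[mu]_s (B%:E * (exponential_pdf 2^-1 s)%:E))%E).
  apply: ge0_le_integral => //.
  - by move=> s _; rewrite lee_fin.
  - exact/measurable_EFinP.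
  - by apply: emeasurable_funM => //; exact/measurable_EFinP.
  move=> s _; rewrite -EFinM lee_fin.
  have [s0|s0] := ltP 0 s; last first.
    by rewrite /kernel weight_le0// mulr0 mulr_ge0// exponential_pdf_ge0// ltW.
  rewrite exponential_pdfE ?(ltW s0)// /kernel weight_gt0E//.
  have : (p * s) `^ (n.+1%:R / p) <= (p * a * expR (s / a)) `^ (n.+1%:R / p).
    apply: ge0_ler_powR; rewrite ?nnegrE ?(ltW dim_gt0)//.
    - by rewrite mulr_ge0 ?(ltW p0) ?(ltW s0).
    - by rewrite mulr_ge0 ?expR_ge0// mulr_ge0 ?(ltW p0) ?(ltW a0).
    rewrite -mulrA ler_pM2l// mulrC -ler_pdivrMr// (le_trans _ (expR_ge1Dx _))//.
    by rewrite lerDr.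
  have -> : (p * a * expR (s / a)) `^ (n.+1%:R / p) =
      (p * a) `^ (n.+1%:R / p) * expR (s / a * (n.+1%:R / p)).
    by rewrite powRM ?expR_ge0 ?expRM// mulr_ge0 ?(ltW p0) ?(ltW a0).
  move=> ub.
  apply: le_trans (ler_wpM2l (expR_ge0 _) ub) _.
  rewrite /B mulrCA -expRD (_ : - s + s / a * (n.+1%:R / p) = - 2^-1 * s).
    by rewrite mulrACA mulfV ?mul1r// gt_eqF.
  have aE : s / a * (n.+1%:R / p) = s / 2.
    by rewrite /a invfM mulrACA -mulrA [_^-1 / _ * _]mulrC; field; rewrite !gt_eqF//.
  by rewrite aE; lra.
rewrite ge0_integralZl_EFin//.
- by rewrite integral_exponential_pdf// mule1 ltry.
- by move=> s _; rewrite lee_fin exponential_pdf_ge0// ltW.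
- exact/measurable_EFinP.
Qed.

Let integral_kernel (v : \bar R) : (0 <= v)%E ->
  (\int[mu]_s ((expR (- s))%:E * ((weight s)%:E * v)) = C * v)%E.
Proof.
move=> v0; rewrite muleC -ge0_integralZl//.
- by apply: eq_integral => s _; rewrite muleA -EFinM muleC.
- exact/measurable_EFinP.
- by move=> s _; rewrite lee_fin.
Qed.

Let integral_expRNV : (\int[vol]_x (expR (- V x))%:E = C * vol L)%E.
Proof.
have contV : continuous V.
  by move=> x; apply: differentiable_continuous; case: C2V.
transitivity (\int[vol]_x expeR (- (EFin \o V) x))%E; first by [].
rewrite integral_expeRN; last first.
  apply: measurable_closed_sublevel => s.
  rewrite (_ : [set x | _] = V @^-1` [set t : R | t <= s]).
    by apply: preimage_closed; [move=> x _; exact: contV|exact: closed_le].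
  by apply/seteqP; split => x /=; rewrite lee_fin.
rewrite -integral_kernel ?lebesgue_outer_ge0//; apply: eq_integral => s _.
by congr (_ * _)%E; rewrite -vol_sublevel; congr (vol _); apply/seteqP; split => x /=; rewrite lee_fin.
Qed.

Let le_integral_expeRN (F : rV -> \bar R) A :
  (forall s : R, closed [set x | (F x <= s%:E)%E]) ->
  (forall s x, 0 < s -> A ((dilation s)^-1 *: x) -> (F x <= s%:E)%E) ->
  (C * vol A <= \int[vol]_x expeR (- F x))%E.
Proof.
move=> cF AF; have mF := measurable_closed_sublevel cF.
rewrite integral_expeRN// -integral_kernel ?lebesgue_outer_ge0//.
have mexp : measurable_fun [set: R] (fun s => (expR (- s))%:E).
  by apply/measurable_EFinP; exact: measurableT_comp.
apply: ge0_le_integral => //.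
- by move=> s _; rewrite !mule_ge0 ?lee_fin ?expR_ge0// lebesgue_outer_ge0.
- apply: emeasurable_funM => //; apply: emeasurable_funM => //.
  exact/measurable_EFinP.
- by apply: emeasurable_funM => //; exact: measurable_sublevel_measure.
move=> s _; apply: lee_wpmul2l; first by rewrite lee_fin expR_ge0.
have [s0|s0] := ltP 0 s; last by rewrite weight_le0// mul0e lebesgue_outer_ge0.
by rewrite -vol_dilation//; apply: le_lebesgue_outer => x; exact: AF.
Qed.

Let gradVZ l x : 0 < l -> grad V (l *: x) = l `^ (p - 1) *: grad V x.
Proof. exact: gradZ. Qed.

(** * From functions to bodies *)

Let q_ge0 : 0 <= (p - 1) / p. Proof. by rewrite divr_ge0 ?(ltW p10) ?(ltW p0). Qed.

Let young (a b : R) : 0 <= a -> 0 <= b ->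
  a `^ (p - 1) * b <= (p - 1) / p * a `^ p + b `^ p / p.
Proof.
move=> a0 b0.
have := @conjugate_powR R (a `^ (p - 1)) b (p / (p - 1)) p.
rewrite powR_ge0 b0 divr_gt0// p0 => /(_ isT isT isT isT).
rewrite -powRrM (_ : (p - 1) * (p / (p - 1)) = p); last first.
  by rewrite mulrCA mulfV ?mulr1// gt_eqF.
rewrite invf_div => h; rewrite [_ / p * _]mulrC; apply: h.
by rewrite -[X in _ + X]mul1r -mulrDl subrK mulfV// gt_eqF.
Qed.

(** For a symmetric convex body [K] with support function [h_K], this is
    [(p-1)/p * h_K(z)^(p/(p-1))], the Legendre transform of [gauge_K^p / p]. As an infimum it is
    bounded above by exhibiting a single point of the polar. *)
Let conj_gauge K z : \bar R := ereal_inf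
  [set ((p - 1) / p * m `^ p)%:E | m in [set m | 0 <= m /\
     exists2 y, polar K y & z = m `^ (p - 1) *: y]].

Let conj_gauge_ge0 K z : (0 <= conj_gauge K z)%E.
Proof.
apply: le_ereal_inf_tmp => _ [m [m0 _] <-].
by rewrite lee_fin (mulr_ge0 q_ge0)// powR_ge0.
Qed.

Let conj_gauge_le K y m : 0 <= m -> polar K y ->
  (conj_gauge K (m `^ (p - 1) *: y) <= ((p - 1) / p * m `^ p)%:E)%E.
Proof. by move=> m0 Ky; apply: ereal_inf_lbound; exists m => //; split => //; exists y. Qed.

Lemma functional_geometric :
  (forall Phi : rV -> \bar R,
      even_fun Phi -> econvex Phi -> proper_fun Phi ->
      (\int[vol]_x expeR (- Phi x) *
       (\int[vol]_x
          expeR (- ((p - 1)^-1%:E * legendre Phi (grad V x)))) `^ (p - 1)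
       <= (\int[vol]_x (expR (- V x))%:E) `^ p)%E) ->
  forall K, convex_body K -> origin_symmetric K ->
      (vol K * vol (grad (legendreR V) @` polar K) `^ (p - 1)
       <= vol L `^ p)%E.
Proof.
move=> func K _ symK.
(* [G] stands for the transform of [Phi]: the bound [legendre Phi <= G], an instance of the
   biconjugate inequality, is all that the second integral requires. *)
pose G := conj_gauge K; pose Phi := legendre G.
have evenG : even_fun G.
  have polN y : polar K y -> polar K (- y).
    by move=> Ky x Kx; rewrite dotpNr -dotpNl; apply/Ky/symK.
  move=> z; congr (ereal_inf _).
  apply/seteqP; split => _ [m [m0 [y Ky zE]] <-]; exists m => //; split => //;
    exists (- y); rewrite ?scalerN -?zE ?opprK//; exact: polN.
have Phi_ge0 x : (0 <= Phi x)%E.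
  apply: le_ereal_sup_tmp; exists ((dotp 0 x)%:E - G (0 : rV)%R)%E; first by exists (0 : rV).
  have pol0 : polar K 0 by move=> x' _; rewrite dotpC dotp0l ler01.
  have G0 : G 0 = 0%E.
    apply/eqP; rewrite eq_le conj_gauge_ge0 andbT.
    have := conj_gauge_le (lexx 0) pol0.
    by rewrite scaler0 powR0 ?gt_eqF// mulr0.
  by rewrite G0 dotp0l sube0.
have Phi_le s x : 0 < s -> K ((dilation s)^-1 *: x) -> (Phi x <= s%:E)%E.
  move=> s0 Kx; apply/legendre_leP => z.
  have d0 := dilation_gt0 s0.
  suff : ((dotp z x - s)%:E <= G z)%E.
    by case: (G z) => [g| |] //=; [rewrite -EFinB !lee_fin; lra|rewrite addeNy leNye].
  apply: le_ereal_inf_tmp => _ [m [m0 [y Ky ->]] <-]; rewrite lee_fin.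
  (* With [d = dilation s], polarity gives [dotp z x <= m^(p-1) d], and Young bounds this by
     [(p-1)/p m^p + d^p / p], whose last term is [s]. *)
  have := young m0 (ltW d0); rewrite dilationK// [p * s]mulrC mulfK ?gt_eqF//.
  have : m `^ (p - 1) * dotp ((dilation s)^-1 *: x) y <= m `^ (p - 1) * 1.
    by rewrite ler_wpM2l ?powR_ge0// Ky.
  rewrite mulr1 [dotp (_^-1 *: x) y]dotpZl mulrCA ler_pdivrMl// [dotp (_ *: y) x]dotpZl [dotp y x]dotpC [dilation s * _]mulrC.
  lra.
have evenPhi : even_fun Phi by exact: legendre_even.
have convPhi : econvex Phi.
  by apply: legendre_econvex => x; apply: lt_le_trans (Phi_ge0 x); rewrite ltNy0.
have properPhi : proper_fun Phi.
  exists 0; have Phi00 : (Phi (0 : rV)%R <= 0)%E.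
    apply/legendre_leP => z; rewrite dotpC dotp0l sub0e oppe_le0.
    exact: conj_gauge_ge0.
  by apply/eqP => Phioo; move: Phi00; rewrite Phioo.
have cgrad := continuous_grad C2V.
have ineq := func _ evenPhi convPhi properPhi.
rewrite (image_grad_legendreR p1 evenV convV homV C2V).
set N := [set x | polar K (grad V x)].
have K_le : (C * vol K <= \int[vol]_x expeR (- Phi x))%E.
  apply: le_integral_expeRN; [exact: closed_legendre|exact: Phi_le].
have scale_le (w : \bar R) s : (((p - 1)^-1)%:E * w <= s%:E)%E = (w <= ((p - 1) * s)%:E)%E.
  by rewrite EFinM -lee_pdivrMl// muleC.
have N_le : (C * vol N <= \int[vol]_x
    expeR (- ((p - 1)^-1%:E * legendre Phi (grad V x))))%E.
  apply: (le_integral_expeRN (F := fun x => ((p - 1)^-1%:E * legendre Phi (grad V x))%E)).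
    move=> s; rewrite (_ : [set x | _] = grad V @^-1`
        [set y | (legendre Phi y <= ((p - 1) * s)%:E)%E]).
      by apply: preimage_closed; [move=> x _; exact: cgrad|exact: closed_legendre].
    by apply/seteqP; split => x /=; rewrite scale_le.
  move=> s x s0; set d := dilation s => Nx; rewrite scale_le.
  have d0 : 0 < d by exact: dilation_gt0.
  (* Then [grad V x] is [d^(p-1)] times a point of the polar, where [G] is at most
     [(p-1)/p d^p = (p-1) s]. *)
  have -> : x = d *: (d^-1 *: x) by rewrite scalerA mulfV ?scale1r// gt_eqF.
  rewrite gradVZ//; apply: le_trans (legendre_biconjugate_le _ _) _.
    by move=> z; apply: lt_le_trans (conj_gauge_ge0 K z); rewrite ltNy0.
  apply: le_trans (conj_gauge_le (ltW d0) Nx) _.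
  by rewrite lee_fin dilationK// mulrA divfK// gt_eqF.
have vol0 A : (0 <= vol A)%E by exact: lebesgue_outer_ge0.
have Cfin : C \is a fin_num by rewrite ge0_fin_numE// ltW.
have C0 := ltW C_gt0.
have : (C * vol K * (C * vol N) `^ (p - 1) <= (C * vol L) `^ p)%E.
  rewrite -integral_expRNV; apply: le_trans ineq; apply: lee_pmul => //.
  - exact: mule_ge0.
  - exact: poweR_ge0.
  apply: gt0_ler_poweR => //; rewrite ?(ltW p10)// in_itv/= ?leey andbT.
    exact: mule_ge0.
  by apply: integral_ge0 => x _; exact: expeR_ge0.
have Cp : (C `^ p = C * C `^ (p - 1))%E.
  have pE : p = 1 + (p - 1) by rewrite addrC subrK.
  rewrite [in LHS]pE [LHS]poweRD ?poweRe1//.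
  by apply: add_neq0_poweRD_def; rewrite -pE gt_eqF.
rewrite !poweRM// muleACA -Cp lee_pmul2l ?poweR_gt0//.
exact: fin_num_poweR.
Qed.

(** * From bodies to functions *)

Let grad_bounded r : exists2 B, 0 <= B & forall y, `|y| <= r -> `|grad V y| <= B.
Proof.
have cgrad := continuous_grad C2V.
pose D : set rV := [set y | `|y| <= r].
have cD : compact D.
  apply: bounded_closed_compact.
    by exists r; split => [|M rM x /= h]; [exact: num_real|exact: le_trans h (ltW rM)].
  have -> : D = (fun x : rV => `|x|) @^-1` [set t : R | t <= r] by [].
  apply: preimage_closed; last exact: closed_le.
  by move=> x _; exact: norm_continuous.
have [r0|r0] := ltP r 0.
  by exists 0 => // y yr; move: (le_lt_trans yr r0); rewrite normr_lt0.
have D0 : D !=set0 by exists 0; rewrite /D/= normr0.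
have [|y0 y0D max] := EVT_max_rV D0 cD (f := fun y => `|grad V y|).
  apply: continuous_subspaceT => y.
  by apply: continuous_comp; [exact: cgrad|exact: norm_continuous].
by exists `|grad V y0| => // y yr; apply: max; exact/mem_set.
Qed.

(* A and grad V (M) being mutually polar up to the factor r, A is enlarged to a
   symmetric convex body K without losing polarity, and homogeneity of grad V
   absorbs the factor r. *)
Let mutually_polar_bounded A M N r :
  (forall K, convex_body K -> origin_symmetric K ->
      (vol K * vol (grad (legendreR V) @` polar K) `^ (p - 1)
       <= vol L `^ p)%E) ->
  0 < r -> (forall x, A x -> `|x| <= N) -> (forall y, M y -> `|y| <= N) ->
  (forall x y, A x -> M y -> `|dotp x (grad V y)| <= r) ->
  (vol A * vol M `^ (p - 1) <= (r ^+ n.+1)%:E * vol L `^ p)%E.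
Proof.
move=> geom r0 AN MN AM.
(* A positive radius, so that the ball cutting [K] has interior points whatever [N] is. *)
pose N1 := Num.max N 1.
have N1_gt0 : 0 < N1 by rewrite lt_max ltr01 orbT.
pose K := [set x | `|x| <= N1 /\ forall y, M y -> `|dotp x (grad V y)| <= r].
have [B B0 gB] := grad_bounded N.
have symK : origin_symmetric K.
  by move=> x [xN xM]; split; rewrite ?normrN// => y /xM; rewrite dotpNl normrN.
have bodyK : convex_body K.
  split.
  - apply: bounded_closed_compact.
      by exists N1; split => [|m N1m x [h _]]; [exact: num_real|exact: le_trans h (ltW N1m)].
    have -> : K = (fun x : rV => `|x|) @^-1` [set t : R | t <= N1] `&`
        \bigcap_(y in M) (dotp ^~ (grad V y)) @^-1` [set t : R | `|t| <= r].
      by apply/seteqP; split.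
    apply: closedI.
      apply: preimage_closed; last exact: closed_le.
      by move=> x _; exact: norm_continuous.
    apply: closed_bigI => y _; apply: preimage_closed.
      by move=> x _; exact: continuous_dotp.
    have -> : [set t : R | `|t| <= r] = (fun t : R => `|t|) @^-1` [set t : R | t <= r] by [].
    apply: preimage_closed; last exact: closed_le.
    by move=> x _; exact: norm_continuous.
  - apply: convex_setP => x y t /andP[t0 t1] [xN xM] [yN yM].
    have t1' : 0 <= 1 - t by rewrite subr_ge0.
    split.
      apply: le_trans (ler_normD _ _) _; rewrite !normrZ !ger0_norm//.
      have : t * `|x| <= t * N1 by rewrite ler_wpM2l.
      have : (1 - t) * `|y| <= (1 - t) * N1 by rewrite ler_wpM2l.
      lra.
    move=> z Mz; rewrite dotpDl !dotpZl.
    apply: le_trans (ler_normD _ _) _; rewrite !normrM (ger0_norm t0) (ger0_norm t1').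
    have : t * `|dotp x (grad V z)| <= t * r by rewrite ler_wpM2l// xM.
    have : (1 - t) * `|dotp y (grad V z)| <= (1 - t) * r by rewrite ler_wpM2l// yM.
    lra.
  (* For [|x| <= e] the pairing with [grad V y] is at most [n.+1 |x| B <= r]; the added 1 keeps the
     denominator positive when [B = 0]. *)
  - pose e := Num.min N1 (r / (n.+1%:R * B + 1)).
    have nB0 : 0 < n.+1%:R * B + 1 by rewrite ltr_wpDl// mulr_ge0.
    have e0 : 0 < e by rewrite lt_min N1_gt0 divr_gt0.
    exists 0; rewrite /interior/=; near=> x.
    have xe : `|x| <= e.
      near: x; have := @nbhs0_le R rV e e0; apply: filterS => x; exact.
    have [xN xr] : `|x| <= N1 /\ `|x| <= r / (n.+1%:R * B + 1).
      by apply/andP; rewrite -le_min.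
    split => // y My; apply: le_trans (ler_norm_dotp _ _) _.
    have sumx : \sum_i `|x 0 i| <= n.+1%:R * `|x|.
      have -> : n.+1%:R * `|x| = \sum_(i < n.+1) `|x|.
        by rewrite sumr_const card_ord mulr_natl.
      by apply: ler_sum => i _; exact: ler_coord_norm.
    apply: (@le_trans _ _ (n.+1%:R * `|x| * B)).
      by apply: ler_pM => //; [exact: sumr_ge0|apply: gB; exact: MN].
    rewrite mulrAC; apply: (@le_trans _ _ ((n.+1%:R * B + 1) * `|x|)).
      by rewrite ler_wpM2r// lerDl.
    by rewrite mulrC -ler_pdivlMr.
have := geom _ bodyK symK; rewrite (image_grad_legendreR p1 evenV convV homV C2V).
set P := [set x | polar K (grad V x)] => geomK.
(* As [grad V] is homogeneous of degree [p - 1], dividing its argument by [l] divides its value by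
   [r]. The volume factor [l^n.+1], raised to the power [p - 1], becomes [r^n.+1]. *)
pose l := r `^ (p - 1)^-1; have l0 : 0 < l by exact: powR_gt0.
have lr : l `^ (p - 1) = r by rewrite -powRrM mulVf ?powRr1 ?(ltW r0)// gt_eqF.
have AK : A `<=` K.
  by move=> x Ax; split => [|y My]; [rewrite le_max AN|exact: AM].
have MP : M `<=` [set y | P (l^-1 *: y)].
  move=> y My x [_ xM]; rewrite gradVZ ?invr_gt0// dotpZr.
  have -> : l^-1 `^ (p - 1) = r^-1.
    by rewrite -lr -[l^-1]powR_inv1 ?(ltW l0)// -powRrM mulN1r powRN.
  by rewrite ler_pdivrMl// mulr1 (le_trans (ler_norm _))// xM.
have vol0 D : (0 <= vol D)%E by exact: lebesgue_outer_ge0.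
apply: (@le_trans _ _ (vol K * ((l ^+ n.+1)%:E * vol P) `^ (p - 1))%E).
  apply: lee_pmul; rewrite ?poweR_ge0//; first exact: le_lebesgue_outer.
  apply: gt0_ler_poweR; rewrite ?in_itv/= ?leey ?andbT ?(ltW p10)//.
    by rewrite mule_ge0// lee_fin exprn_ge0// ltW.
  by rewrite -lebesgue_rVZ//; exact: le_lebesgue_outer.
rewrite poweRM//; last by rewrite lee_fin exprn_ge0// ltW.
rewrite muleCA poweR_EFin -powR_mulrn ?(ltW l0)// -powRrM mulrC powRrM lr powR_mulrn ?(ltW r0)//.
by apply: lee_wpmul2l => //; rewrite lee_fin exprn_ge0// ltW.
Unshelve. all: by end_near. Qed.

Let vol_exhaustion A : closed A ->
  vol (A `&` [set x | `|x| <= k%:R]) @[k --> \oo] --> vol A.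
Proof.
move=> cA; have cB k : closed [set x : rV | `|x| <= k%:R].
  have -> : [set x : rV | `|x| <= k%:R] = (fun x : rV => `|x|) @^-1` [set t : R | t <= k%:R] by [].
  apply: preimage_closed; last exact: closed_le.
  by move=> x _; exact: norm_continuous.
have mB k : (@lebesgue_outer R n).-cara.-measurable (A `&` [set x | `|x| <= k%:R]).
  by apply: measurable_closed_rV; exact: closedI.
have AE : A = \bigcup_k (A `&` [set x | `|x| <= k%:R]).
  apply/seteqP; split => [x Ax|x [k _ []]//].
  by exists (Num.truncn `|x|).+1 => //; split => //=; apply/ltW/truncnS_gt.
rewrite [in X in _ --> X]AE; apply: (@nondecreasing_cvg_mu _ _ _ vol) => //.
  by rewrite -AE; exact: measurable_closed_rV.
move=> i j ij; apply/subsetPset => x [Ax /= xi]; split => //=.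
by apply: le_trans xi _; rewrite ler_nat.
Qed.

(** The right-hand side is the p-th power of the volume of [{V <= r / p}], zero for [r <= 0].
    Exhaustion by balls removes boundedness, and a nonpositive [r] is reached by applying the bound
    to arbitrarily small positive [d]. *)
Let mutually_polar A M r :
  (forall K, convex_body K -> origin_symmetric K ->
      (vol K * vol (grad (legendreR V) @` polar K) `^ (p - 1)
       <= vol L `^ p)%E) ->
  closed A -> closed M -> origin_symmetric A ->
  (forall x y, A x -> M y -> dotp x (grad V y) <= r) ->
  (vol A * vol M `^ (p - 1) <= ((weight (p^-1 * r) * vL) `^ p)%:E)%E.
Proof.
move=> geom cA cM symA AM.
have absAM x y : A x -> M y -> `|dotp x (grad V y)| <= r.
  move=> Ax My; rewrite ler_norml AM// andbT lerNl -dotpNl; apply: AM => //.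
  exact: symA.
have pos_case r' : 0 < r' -> r <= r' ->
    (vol A * vol M `^ (p - 1) <= (r' ^+ n.+1)%:E * vol L `^ p)%E.
  move=> r'0 rr'.
  apply: (le_mul_poweR_lim p10 _ _ (vol_exhaustion cA) (vol_exhaustion cM)).
  - by move=> i; exact: lebesgue_outer_ge0.
  - by move=> i; exact: lebesgue_outer_ge0.
  move=> i j; apply: (@mutually_polar_bounded _ _ (maxn i j)%:R) => //.
  - by move=> x [_ /= xi]; apply: le_trans xi _; rewrite ler_nat leq_maxl.
  - by move=> x [_ /= xi]; apply: le_trans xi _; rewrite ler_nat leq_maxr.
  - by move=> x y [Ax _] [My _]; apply: le_trans (absAM _ _ Ax My) rr'.
have weightE s : 0 < s -> (weight (p^-1 * s) * vL) `^ p = s ^+ n.+1 * vL `^ p.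
  move=> s0; rewrite powRM ?weight_ge0// weight_gt0E ?mulr_gt0 ?invr_gt0//.
  by rewrite mulrA mulfV ?gt_eqF// mul1r -powRrM divfK ?gt_eqF// powR_mulrn// ltW.
have [r0|r0] := ltP 0 r.
  by apply: le_trans (pos_case _ r0 (lexx _)) _; rewrite vol_LE weightE// EFinM poweR_EFin.
rewrite weight_le0 ?mul0r ?powR0 ?gt_eqF//; last by rewrite pmulr_rle0// invr_gt0.
apply/lee_addgt0Pr => e e0; rewrite add0e.
pose c := vL `^ p + 1; have c0 : 0 < c by rewrite ltr_wpDl// powR_ge0.
(* Since [d <= 1], [d^n.+1 <= d], hence [d^n.+1 vL^p <= d c <= e]. *)
pose d := Num.min 1 (e / c).
have d0 : 0 < d by rewrite lt_min ltr01 divr_gt0.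
have d1 : d <= 1 by rewrite ge_min lexx.
have dc : d <= e / c by rewrite ge_min lexx orbT.
apply: le_trans (pos_case _ d0 (le_trans r0 (ltW d0))) _.
rewrite vol_LE poweR_EFin -EFinM lee_fin.
apply: (@le_trans _ _ (d * c)); last by rewrite -ler_pdivlMr.
apply: ler_pM; rewrite ?exprn_ge0 ?powR_ge0 ?(ltW d0)//; last by rewrite lerDl.
by rewrite exprS ler_piMr ?(ltW d0)// exprn_ile1// ltW.
Qed.

Lemma geometric_functional :
  (forall K, convex_body K -> origin_symmetric K ->
      (vol K * vol (grad (legendreR V) @` polar K) `^ (p - 1)
       <= vol L `^ p)%E) ->
  forall Phi : rV -> \bar R,
      even_fun Phi -> econvex Phi -> proper_fun Phi ->
      (\int[vol]_x expeR (- Phi x) *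
       (\int[vol]_x
          expeR (- ((p - 1)^-1%:E * legendre Phi (grad V x)))) `^ (p - 1)
       <= (\int[vol]_x (expR (- V x))%:E) `^ p)%E.
Proof.
move=> geom Phi evenPhi [PhiNy _] _.
pose Phi2 := legendre (legendre Phi).
pose Psi x := ((p - 1)^-1%:E * legendre Phi (grad V x))%E.
have cgrad := continuous_grad C2V.
have PsiE s : [set x | (Psi x <= s%:E)%E] =
    grad V @^-1` [set y | (legendre Phi y <= ((p - 1) * s)%:E)%E].
  by apply/seteqP; split => x /=; rewrite EFinM -lee_pdivrMl// muleC.
have cPhi2 s : closed [set x | (Phi2 x <= s%:E)%E] by exact: closed_legendre.
have cPsi s : closed [set x | (Psi x <= s%:E)%E].
  rewrite PsiE; apply: preimage_closed; last exact: closed_legendre.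
  by move=> x _; exact: cgrad.
have mPhi2 := measurable_closed_sublevel cPhi2.
have mPsi := measurable_closed_sublevel cPsi.
apply: (@le_trans _ _ (\int[vol]_x expeR (- Phi2 x) *
    (\int[vol]_x expeR (- Psi x)) `^ (p - 1))%E).
  apply: lee_wpmul2r; first exact: poweR_ge0.
  apply: ge0_le_integral_nonmeasurable => x; first exact: expeR_ge0.
  by rewrite lee_expeR leeN2; exact: legendre_biconjugate_le.
have mexp : measurable_fun [set: R] (fun s => (expR (- s))%:E).
  by apply/measurable_EFinP; exact: measurableT_comp.
rewrite !integral_expeRN// integral_expRNV.
have -> : (C * vol L = \int[mu]_s (kernel s * vL)%:E)%E.
  rewrite vol_LE -integral_kernel ?lee_fin//; apply: eq_integral => s _.
  by rewrite /kernel !EFinM muleA.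
apply: prekopa_leindler => //.
- by apply: emeasurable_funM => //; exact: measurable_sublevel_measure.
- by apply: emeasurable_funM => //; exact: measurable_sublevel_measure.
- exact: measurable_funM.
- by move=> s; rewrite mule_ge0 ?lee_fin ?expR_ge0// lebesgue_outer_ge0.
- by move=> s; rewrite mule_ge0 ?lee_fin ?expR_ge0// lebesgue_outer_ge0.
- by move=> s; rewrite mulr_ge0.
move=> s t; set r := s + (p - 1) * t.
(* The exponential factors agree exactly, so the Prekopa-Leindler hypothesis reduces to a comparison
   of volumes at the levels [s], [t] and [r / p]. *)
have expE : expR (- (p^-1 * r)) `^ p = expR (- s) * expR (- t) `^ (p - 1).
  rewrite -!expRM -expRD; congr expR; rewrite /r.
  by rewrite mulNr mulrAC mulVf ?gt_eqF// mul1r; lra.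
rewrite poweRM ?lee_fin ?expR_ge0 ?lebesgue_outer_ge0// muleACA poweR_EFin -EFinM -expE.
rewrite /kernel -mulrA powRM ?expR_ge0 ?mulr_ge0// EFinM.
apply: lee_wpmul2l; first by rewrite lee_fin powR_ge0.
apply: mutually_polar => //.
- move=> x /= xs; rewrite /Phi2 legendre_even//.
  exact: legendre_even.
- move=> x y /= xs; have := PsiE t; move=> /seteqP[sub _] /sub /= yt.
  exact: fenchel_young xs yt.
Qed.

(** * The equality case *)

Let grad0 : grad V 0 = 0.
Proof.
apply/esym/subgradient_unique; first by case: C2V.
move=> z; rewrite dotp0l addr0 (homogeneous0 p1 homV).
have [->|/(homogeneous_gt0 p1 evenV convV homV)/ltW//] := eqVneq z 0.
by rewrite (homogeneous0 p1 homV).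
Qed.

(* The supremum of z |-> <z, grad V x> over {V <= a} is attained on the ray
   through x, where Euler's identity <x, grad V x> = p V x computes it. *)
Let polar_sublevelE a x : 0 < a ->
  polar [set z | V z <= a] (grad V x) <->
  p * a `^ p^-1 * V x `^ ((p - 1) / p) <= 1.
Proof.
move=> a0; have [->|xn0] := eqVneq x 0.
  rewrite (homogeneous0 p1 homV) powR0 ?mulr0 ?gt_eqF ?divr_gt0// ler01.
  by split => // _ z _; rewrite grad0 dotpC dotp0l ler01.
have Vx0 := homogeneous_gt0 p1 evenV convV homV xn0.
have euler := dotp_gradE convV homV C2V x.
(* The factor for which [l^-1 x] lies on the level set [V = a]. *)
pose l := (V x / a) `^ p^-1.
have l0 : 0 < l by rewrite powR_gt0// divr_gt0.
have lp : l `^ p = V x / a by rewrite powRVK// divr_ge0 ?(ltW a0) ?(ltW Vx0).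
have lE : p * V x = l * (p * a `^ p^-1 * V x `^ ((p - 1) / p)).
  have VxE : V x = V x `^ p^-1 * V x `^ ((p - 1) / p).
    rewrite -powRD; last by apply/implyP => _; rewrite gt_eqF.
    have -> : p^-1 + (p - 1) / p = 1 by field; rewrite gt_eqF.
    by rewrite powRr1// ltW.
  have laE : l * a `^ p^-1 = V x `^ p^-1.
    by rewrite -powRM ?(ltW l0) ?divr_ge0 ?(ltW a0) ?(ltW Vx0)// divfK ?gt_eqF.
  by rewrite {1}VxE -laE; ring.
split => [pol|le1 z /= za].
  have := pol (l^-1 *: x); rewrite /= homV ?invr_ge0 ?(ltW l0)//.
  have -> : l^-1 `^ p = a / V x.
    by rewrite -[l^-1]powR_inv1 ?(ltW l0)// -powRrM mulN1r powRN lp invf_div.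
  rewrite divfK ?gt_eqF// lexx => /(_ isT).
  by rewrite dotpZl dotpC euler ler_pdivrMl// mulr1 lE ger_pMr.
(* Since [V (l z) = (V x / a) V z <= V x], the subgradient inequality leaves
   [l <z, grad V x> <= p V x]. *)
have := subgradient_grad convV C2V x (l *: z).
rewrite homV ?(ltW l0)// lp dotpDr dotpNr euler dotpZr [dotp _ z]dotpC => h.
have : V x / a * V z <= V x / a * a by rewrite ler_wpM2l// divr_ge0 ?(ltW a0) ?(ltW Vx0).
rewrite divfK ?gt_eqF// => h2.
have : l * dotp z (grad V x) <= p * V x by lra.
by rewrite lE ler_pM2l// => /le_trans; apply.
Qed.

Lemma sublevel_equality a : 0 < a ->
  (vol [set x | (V x <= a)%R] *
   vol (grad (legendreR V) @` polar [set x | (V x <= a)%R]) `^ (p - 1)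
   = vol L `^ p)%E.
Proof.
move=> a0; rewrite (image_grad_legendreR p1 evenV convV homV C2V).
(* The level obtained by solving the criterion of [polar_sublevelE] for [V x]. *)
pose b := (p * a `^ p^-1) `^ (- (p / (p - 1))).
have pa0 : 0 < p * a `^ p^-1 by rewrite mulr_gt0// powR_gt0.
have b0 : 0 < b by exact: powR_gt0.
have Vge0 x : 0 <= V x.
  have [->|/(homogeneous_gt0 p1 evenV convV homV)/ltW//] := eqVneq x 0.
  by rewrite (homogeneous0 p1 homV).
have -> : [set x | polar [set z | V z <= a] (grad V x)] = [set x | V x <= b].
  have bq : b `^ ((p - 1) / p) = (p * a `^ p^-1)^-1.
    rewrite -powRrM mulNr (_ : p / (p - 1) * _ = 1) ?powR_inv1 ?(ltW pa0)//.
    by field; rewrite !gt_eqF.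
  have key x : (p * a `^ p^-1 * V x `^ ((p - 1) / p) <= 1) = (V x <= b).
    rewrite mulrC -ler_pdivlMr// div1r -bq.
    apply/idP/idP => [h|h]; last first.
      by apply: ge0_ler_powR; rewrite ?nnegrE ?(ltW b0).
    rewrite leNgt; apply/negP => bV; move: h; rewrite leNgt => /negP; apply.
    by apply: gt0_ltr_powR; rewrite ?nnegrE ?(ltW b0)// divr_gt0.
  by apply/seteqP; split => x /=; rewrite polar_sublevelE// key.
have volE s : vol [set x | V x <= s] = (weight s * vL)%:E.
  by rewrite vol_sublevel vol_LE.
transitivity (weight a * vL * (weight b * vL) `^ (p - 1))%:E.
  by rewrite (volE a) (volE b).
rewrite vol_LE poweR_EFin; congr (_%:E).
rewrite powRM// mulrACA !weight_gt0E//.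
(* The two dilations compensate because [b^(p-1) = p^(-p) a^(-1)], that is
   [(p a) (p b)^(p-1) = 1]. *)
have -> : (p * a) `^ (n.+1%:R / p) * ((p * b) `^ (n.+1%:R / p)) `^ (p - 1) = 1.
  set k := n.+1%:R / p.
  have -> : ((p * b) `^ k) `^ (p - 1) = ((p * b) `^ (p - 1)) `^ k.
    by rewrite -!powRrM [k * _]mulrC.
  have pa_ge0 : 0 <= p * a by rewrite mulr_ge0 ?(ltW p0) ?(ltW a0).
  rewrite -powRM ?powR_ge0//.
  rewrite (_ : p * a * _ = 1) ?powR1//.
  rewrite powRM ?(ltW p0) ?(ltW b0)// /b -powRrM.
  rewrite (_ : - (p / (p - 1)) * (p - 1) = - p); last first.
    by field; rewrite gt_eqF.
  rewrite powRN powRM ?(ltW p0) ?powR_ge0// powRVK ?(ltW a0)//.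
  have -> : p `^ p = p * p `^ (p - 1).
    rewrite -[X in X * _](powRr1 (ltW p0)) -powRD ?subrKC//.
    by apply/implyP => _; rewrite gt_eqF.
  by field; rewrite !gt_eqF// powR_gt0.
rewrite mul1r -[X in X * _ = _]powRr1// -powRD ?subrKC//.
by apply/implyP; rewrite gt_eqF.
Qed.

End main.

Theorem proposition1p3 (R : realType) (n : nat) (p : R)
    (V : 'rV[R]_n.+1 -> R) :
  1 < p -> even_fun V -> strictly_convex V -> homogeneous p V -> C2 V ->
  ((forall Phi : 'rV[R]_n.+1 -> \bar R,
      even_fun Phi -> econvex Phi -> proper_fun Phi ->
      (\int[lebesgue_rV]_x expeR (- Phi x) *
       (\int[lebesgue_rV]_x
          expeR (- ((p - 1)^-1%:E * legendre Phi (grad V x)))) `^ (p - 1)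
       <= (\int[lebesgue_rV]_x (expR (- V x))%:E) `^ p)%E)
   <->
   (forall K : set 'rV[R]_n.+1, convex_body K -> origin_symmetric K ->
      (lebesgue_rV K *
       lebesgue_rV (grad (legendreR V) @` polar K) `^ (p - 1)
       <= lebesgue_rV [set x | V x <= p^-1]%R `^ p)%E))
  /\
  ((forall K : set 'rV[R]_n.+1, convex_body K -> origin_symmetric K ->
      (lebesgue_rV K *
       lebesgue_rV (grad (legendreR V) @` polar K) `^ (p - 1)
       <= lebesgue_rV [set x | V x <= p^-1]%R `^ p)%E) ->
   forall alpha : R, 0 < alpha ->
     let K := [set x | V x <= alpha] in
     [/\ convex_body K, origin_symmetric K &
      (lebesgue_rV K *
       lebesgue_rV (grad (legendreR V) @` polar K) `^ (p - 1)
       = lebesgue_rV [set x | V x <= p^-1]%R `^ p)%E]).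
Proof.
move=> p1 evenV convV homV C2V.
have geom_func := geometric_functional p1 evenV convV homV C2V.
have func_geom := functional_geometric p1 evenV convV homV C2V.
split; first by split; [exact: func_geom|exact: geom_func].
move=> _ alpha alpha0 K; split.
- exact: sublevel_convex_body p1 evenV convV homV C2V _ alpha0.
- by move=> x; rewrite /K/= evenV.
- exact: sublevel_equality.
Qed.
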